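(* Let $\lambda,\mu$ be partitions with at most $n$ parts and $\mu\subseteq\lambda$. Then \[ G_{\lambda/\mu}(\mathbf x;\boldsymbol\alpha,\boldsymbol\beta)=C\sum_{\substack{\rho,\nu\in\mathrm{GPar}_n\\ \rho\subseteq\mu\subseteq\lambda\subseteq\nu}}C_{\lambda,\nu}(\boldsymbol\alpha,\boldsymbol\beta)\,s_{\nu/\rho}(\mathbf x)\,C'_{\rho,\mu}(\boldsymbol\alpha,\boldsymbol\beta), \] where $C=\prod_{i=1}^n\prod_{l\ge1}(1-\beta_ix_l)$, $C_{\lambda,\nu}(\boldsymbol\alpha,\boldsymbol\beta)=\det(h_{\nu_i-\lambda_j-i+j}[A_{\lambda_j}-B_{j-1}])_{i,j=1}^n$ and $C'_{\rho,\mu}(\boldsymbol\alpha,\boldsymbol\beta)=\det(h_{\mu_i-\rho_j-i+j}[-A_{\mu_i}+B_i])_{i,j=1}^n$.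
   Context: $\mathrm{GPar}_n$ is the set of generalized partitions $(\nu_1\ge\dots\ge\nu_n)\in\mathbb Z^n$ (entries may be negative); partitions with at most $n$ parts are regarded as elements of it, and $\rho\subseteq\nu$ means $\rho_i\le\nu_i$ for all $i$. For $\nu,\rho\in\mathrm{GPar}_n$, $s_{\nu/\rho}(\mathbf x)=\det(h_{\nu_i-\rho_j-i+j}(\mathbf x))_{i,j=1}^n$. $A_k=\alpha_1+\dots+\alpha_k$, $B_k=\beta_1+\dots+\beta_k$ for $k\ge1$, $A_k=B_k=0$ for $k\le0$. For a formal $\mathbb Z$-linear combination $Z=\sum_uc_uu$ of parameters, $\sum_{m\ge0}h_m[Z]t^m=\prod_u(1-ut)^{-c_u}$, $h_m[Z]=0$ for $m<0$. $G_{\lambda/\mu}(\mathbf x;\boldsymbol\alpha,\boldsymbol\beta)$ is the sum of $\mathrm{wt}(T)$ over all marked multiset-valued tableaux $T$ of shape $\lambda/\mu$: fillings of each cell $(i,j)$ with a nonempty multiset $\{a_1\le\dots\le a_k\}$ of positive integers, where each $a_t$ with $t\ge2$ and $a_{t-1}<a_t$ may be marked, such that $\max T(i,j)\le\min T(i,j+1)$ and $\max T(i,j)<\min T(i+1,j)$ whenever the cells are in the shape; $\mathrm{wt}(T)=\prod_{(i,j)}\mathbf x^{T(i,j)}\alpha_j^{u(T(i,j))-1}(-\beta_i)^{m(T(i,j))}$, with $\mathbf x^{T(i,j)}$ the product of $x_k$ over all elements with multiplicity and $u,m$ the numbers of unmarked and marked elements. *)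

(* Defs.v *)
From HB Require Import structures.
From mathcomp Require Import all_boot all_order all_algebra finmap.
From mathcomp Require Import boolp classical_sets functions cardinality fsbigop.
From mathcomp Require Import monalg.

Set Implicit Arguments.
Unset Strict Implicit.
Unset Printing Implicit Defensive.

Import GRing.Theory.

Local Open Scope classical_set_scope.
Local Open Scope ring_scope.

(* Everything that is numbered from 1 on paper is numbered from 0 here: [x_k],
   [alpha_k], [beta_k], tableau entries, rows and columns. The paper's objects
   of index k + 1 are ours of index k. *)

(* Formal power series in the variables x_0, x_1, ... over R: all functions
   from monomials to R, with the Cauchy product. *)

Notation mon := {cmonom nat}.

Record fps (R : Type) := FPS { fcoef : mon -> R }.

HB.instance Definition _ (R : Type) := [isNew for @fcoef R].
HB.instance Definition _ (R : choiceType) := [Choice of fps R by <:].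

Lemma fpsP (R : Type) (f g : fps R) : fcoef f =1 fcoef g -> f = g.
Proof. by case: f g => [f] [g] /= /funext ->. Qed.

Definition mdivs (m : mon) : {fset mon} :=
  fset_set [set a : mon | forall i, (a i <= m i)%N].

Lemma mdivs_finite (m : mon) : finite_set [set a : mon | forall i, (a i <= m i)%N].
Proof.
pose F (t : {ffun finsupp m -> 'I_(mdeg m).+1}) : mon :=
  mkcmonom [fsfun i : finsupp m => (t i : nat) | 0%N].
apply: (@sub_finite_set _ _ (range F)); last exact/finite_image/finite_finset.
move=> a /= am; have ub i : (a i < (mdeg m).+1)%N.
  rewrite ltnS (leq_trans (am i)) // mdegE.
  have [im|im] := boolP (i \in finsupp m); last by rewrite -[m i]/(cmonom_val m i) fsfun_dflt.
  by rewrite (big_fsetD1 i) //= leq_addr.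
exists [ffun i => Ordinal (ub (val i))] => //.
apply/eqP/cmP => i; rewrite /F cmE /=.
rewrite fsfun_ffun; case: insubP => [u _ <-|] /=; first by rewrite ffunE.
by rewrite -cmE_eq0 => /eqP mi; have := am i; rewrite mi leqn0 => /eqP.
Qed.

Lemma in_mdivs (m a : mon) : reflect (forall i, (a i <= m i)%N) (a \in mdivs m).
Proof.
rewrite in_fset_set; last exact: mdivs_finite.
by apply: (iffP idP); rewrite inE.
Qed.

Lemma divcmP (m a b : mon) :
  (mmul a b == m) = (a \in mdivs m) && (b == divcm m a).
Proof.
apply/idP/andP => [/eqP <-|[/in_mdivs am /eqP ->]].
  split; first by apply/in_mdivs => i; rewrite cmM leq_addr.
  by apply/cmP => i; rewrite divcmE cmM addKn.
by apply/cmP => i; rewrite cmM divcmE subnKC.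
Qed.

Section FpsRing.
Variable R : comNzRingType.
Implicit Types (f g h : fps R) (m d : mon) (p q : {malg R[mon]}).

Definition fps0 : fps R := FPS (fun=> 0).
Definition fps1 : fps R := FPS (fun m => (m == mone)%:R).
Definition fps_opp f := FPS (fun m => - fcoef f m).
Definition fps_add f g := FPS (fun m => fcoef f m + fcoef g m).
Definition fps_mul f g :=
  FPS (fun m => \sum_(a <- mdivs m) fcoef f a * fcoef g (divcm m a)).

Fact fps_addA : associative fps_add.
Proof. by move=> f g h; apply: fpsP => m /=; rewrite addrA. Qed.
Fact fps_addC : commutative fps_add.
Proof. by move=> f g; apply: fpsP => m /=; rewrite addrC. Qed.
Fact fps_add0 : left_id fps0 fps_add.
Proof. by move=> f; apply: fpsP => m /=; rewrite add0r. Qed.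
Fact fps_addN : left_inverse fps0 fps_opp fps_add.
Proof. by move=> f; apply: fpsP => m /=; rewrite addNr. Qed.

HB.instance Definition _ :=
  GRing.isZmodule.Build (fps R) fps_addA fps_addC fps_add0 fps_addN.

(* The ring laws are those of the monoid algebra: the coefficient of m in a
   product is determined by the truncations of the factors to the divisors
   of m. *)
Let trunc m f : {malg R[mon]} := [malg a in mdivs m => fcoef f a].

Let trunc_coef m f a : (trunc m f)@_a = if a \in mdivs m then fcoef f a else 0.
Proof. exact: mcoeffE. Qed.

Let supp_trunc m f : (msupp (trunc m f) `<=` mdivs m)%fset.
Proof.
by apply/fsubsetP => a; rewrite -mcoeff_neq0 trunc_coef; case: ifP; rewrite // eqxx.
Qed.

Let mdivs_trans m a b : a \in mdivs m -> b \in mdivs a -> b \in mdivs m.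
Proof.
by move=> /in_mdivs am /in_mdivs ba; apply/in_mdivs => i; exact: leq_trans (am i).
Qed.

Let malg_mulE p q m : (p * q)@_m = \sum_(a <- mdivs m) p@_a * q@_(divcm m a).
Proof.
have inner a : \sum_(b <- msupp q) (p@_a * q@_b) *+ (mmul a b == m) =
    if a \in mdivs m then p@_a * q@_(divcm m a) else 0.
  under eq_bigr do rewrite divcmP.
  case: (a \in mdivs m) => /=; last by rewrite big1.
  have [bq|bq] := boolP (divcm m a \in msupp q).
    rewrite (big_fsetD1 _ bq) /= eqxx mulr1n big1_fset ?addr0 // => b.
    by rewrite !inE => /andP[/negPf-> _] _.
  rewrite (mcoeff_outdom bq) mulr0 big1_fset // => b bq' _.
  by case: eqP => // bE; rewrite bE (negPf bq) in bq'.
rewrite mcoeffMl; under eq_bigr do rewrite inner.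
rewrite (big_fset_incl _ (fsubsetUl (msupp p) (mdivs m))) /=; last first.
  by move=> a _ /mcoeff_outdom ->; rewrite mul0r if_same.
have <- : \sum_(a <- mdivs m) (if a \in mdivs m then p@_a * q@_(divcm m a) else 0) =
    \sum_(a <- mdivs m) p@_a * q@_(divcm m a) by apply: eq_big_seq => a ->.
rewrite [RHS](big_fset_incl _ (fsubsetUr (msupp p) (mdivs m))) //=.
by move=> a _ /negPf ->.
Qed.

Let mulE m d f g : d \in mdivs m ->
  fcoef (fps_mul f g) d = (trunc m f * trunc m g)@_d.
Proof.
move=> dm; rewrite malg_mulE /=; apply: eq_big_seq => a ad.
have /eqP da : mmul a (divcm d a) == d by rewrite divcmP ad eqxx.
have dad : divcm d a \in mdivs d.
  by apply/in_mdivs => i; rewrite divcmE leq_subr.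
by rewrite !trunc_coef (mdivs_trans dm ad) (mdivs_trans dm dad).
Qed.

Let mdivs_refl m : m \in mdivs m.
Proof. by apply/in_mdivs. Qed.

Let mul_congr p p' q q' m :
    {in mdivs m, forall a, p@_a = p'@_a} -> {in mdivs m, forall a, q@_a = q'@_a} ->
  (p * q)@_m = (p' * q')@_m.
Proof.
move=> pp qq.
apply: (etrans (malg_mulE p q m)); apply: (etrans _ (esym (malg_mulE p' q' m))).
apply: eq_big_seq => a am.
by rewrite pp // qq //; apply/in_mdivs => i; rewrite divcmE leq_subr.
Qed.

Let trunc_mul m f g :
  {in mdivs m, forall a, (trunc m (fps_mul f g))@_a = (trunc m f * trunc m g)@_a}.
Proof. by move=> a am; rewrite trunc_coef am (mulE _ _ am). Qed.

Let trunc1 m : {in mdivs m, forall a, (trunc m fps1)@_a = (1 : {malg R[mon]})@_a}.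
Proof. by move=> a am; rewrite trunc_coef am /= mcoeff1. Qed.

Fact fps_mulC : commutative fps_mul.
Proof.
move=> f g; apply: fpsP => m.
apply: etrans (mulE f g (mdivs_refl m)) _.
apply: etrans _ (esym (mulE g f (mdivs_refl m))).
exact: (congr1 (mcoeff m) (mulrC (trunc m f) (trunc m g))).
Qed.

Fact fps_mulA : associative fps_mul.
Proof.
move=> f g h; apply: fpsP => m.
have lhs : (trunc m f * trunc m (fps_mul g h))@_m =
    (trunc m f * (trunc m g * trunc m h))@_m.
  by apply: mul_congr; [move=> a _ | exact: trunc_mul].
have rhs : (trunc m (fps_mul f g) * trunc m h)@_m =
    (trunc m f * trunc m g * trunc m h)@_m.
  by apply: mul_congr; [exact: trunc_mul | move=> a _].
apply: etrans (mulE f (fps_mul g h) (mdivs_refl m)) _; apply: etrans lhs _.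
apply: etrans _ (esym (mulE (fps_mul f g) h (mdivs_refl m))).
apply: etrans _ (esym rhs).
exact: (congr1 (mcoeff m) (mulrA (trunc m f) (trunc m g) (trunc m h))).
Qed.

Fact fps_mul1 : left_id fps1 fps_mul.
Proof.
move=> f; apply: fpsP => m.
have lhs : (trunc m fps1 * trunc m f)@_m = (1 * trunc m f)@_m.
  by apply: mul_congr; [exact: trunc1 | move=> a _].
apply: etrans (mulE fps1 f (mdivs_refl m)) _; apply: etrans lhs _.
by rewrite mul1r trunc_coef mdivs_refl.
Qed.

Fact fps_mulDl : left_distributive fps_mul fps_add.
Proof.
move=> f g h; apply: fpsP => m /=; rewrite -big_split /=.
by apply: eq_bigr => a _; rewrite mulrDl.
Qed.

Fact fps_oneq0 : fps1 != 0.
Proof.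
apply/eqP => /(congr1 (fun f => fcoef f mone)) /=.
by rewrite eqxx => /eqP; rewrite oner_eq0.
Qed.

HB.instance Definition _ := GRing.Zmodule_isComNzRing.Build (fps R)
  fps_mulA fps_mulC fps_mul1 fps_mulDl fps_oneq0.

Definition fpsC (c : R) : fps R := FPS (fun m => if m == mone then c else 0).

Definition fpsX (k : nat) : fps R := FPS (fun m => (m == ucm k)%:R).

(* Coefficientwise infinite sums. [\sum_(i \in A)] is 0 when infinitely many
   terms are nonzero, so a sum is meaningful only for a summable family. *)

Definition fps_summable (I : choiceType) (A : set I) (F : I -> fps R) : Prop :=
  forall m, finite_set [set i | A i /\ fcoef (F i) m != 0].

Definition fps_sum (I : choiceType) (A : set I) (F : I -> fps R) : fps R :=
  FPS (fun m => \sum_(i \in A) fcoef (F i) m).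

(* Limits for the coefficientwise (discrete) topology: each coefficient takes
   its eventual value, or 0 if it is not eventually constant. *)

Definition fps_lim (u : nat -> fps R) : fps R := FPS (fun m =>
  xget 0 [set c | exists N, forall k, (N <= k)%N -> fcoef (u k) m = c]).

Definition fps_prod (F : nat -> fps R) : fps R :=
  fps_lim (fun L => \prod_(l < L) F l).

Lemma fps_limP (u : nat -> fps R) m N :
    (forall k, (N <= k)%N -> fcoef (u k) m = fcoef (u N) m) ->
  fcoef (fps_lim u) m = fcoef (u N) m.
Proof.
move=> uN; rewrite /=; apply: xget_unique; first by exists N.
by move=> c [N' cN']; rewrite -(uN (maxn N N')) ?leq_maxl // cN' ?leq_maxr.
Qed.

Lemma fcoefB f g m : fcoef (f - g) m = fcoef f m - fcoef g m.
Proof. by []. Qed.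

Lemma fcoefM f g m :
  fcoef (f * g) m = \sum_(a <- mdivs m) fcoef f a * fcoef g (divcm m a).
Proof. by []. Qed.

Lemma fcoef_mulX f k m : m k = 0%N -> fcoef (f * fpsX k) m = 0.
Proof.
move=> mk0; rewrite fcoefM big1_seq // => a /andP[_ am] /=.
case: eqP => [E|_]; last by rewrite mulr0.
by have := divcmE m a k; rewrite E ucmE eqxx mk0.
Qed.

Lemma fcoef_mulBX f (b : R) k m : m k = 0%N ->
  fcoef (f * (1 - fpsC b * fpsX k)) m = fcoef f m.
Proof.
by move=> mk0; rewrite mulrBr mulr1 mulrA fcoefB fcoef_mulX // subr0.
Qed.

Lemma fps_prod_cvg (b : R) m : exists N, forall k, (N <= k)%N ->
  fcoef (\prod_(l < k) (1 - fpsC b * fpsX l)) m =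
  fcoef (fps_prod (fun l => 1 - fpsC b * fpsX l)) m.
Proof.
pose N := (\max_(i <- finsupp m) i.+1)%N.
have mN k : (N <= k)%N -> m k = 0%N.
  move=> Nk; apply/eqP; rewrite cmE_eq0; apply/negP => km.
  have : (k.+1 <= N)%N by apply: (@leq_bigmax_seq _ _ xpredT (fun i => i.+1)).
  by rewrite ltnNge Nk.
have uN k : (N <= k)%N ->
    fcoef (\prod_(l < k) (1 - fpsC b * fpsX l)) m =
    fcoef (\prod_(l < N) (1 - fpsC b * fpsX l)) m.
  move=> /subnKC <-; elim: (k - N)%N => [|j IHj]; first by rewrite addn0.
  by rewrite addnS big_ord_recr fcoef_mulBX // mN // leq_addr.
by exists N => k Nk; rewrite uN // /fps_prod (fps_limP uN).
Qed.

Definition hsym (k : int) : fps R := FPS (fun m => ((mdeg m)%:Z == k)%:R).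

End FpsRing.

Definition gpar (n : nat) : Type := {ffun 'I_n -> int}.

HB.instance Definition _ n := Choice.on (gpar n).

Definition is_gpar n (v : gpar n) : Prop :=
  forall i j : 'I_n, (i <= j)%N -> v j <= v i.

Definition gsub n (rho nu : gpar n) : Prop := forall i, rho i <= nu i.

(* A partition with at most n parts, padded with zeros. *)
Definition is_part n (lam : {ffun 'I_n -> nat}) : Prop :=
  forall i j : 'I_n, (i <= j)%N -> (lam j <= lam i)%N.

Definition gpar_of_part n (lam : {ffun 'I_n -> nat}) : gpar n :=
  [ffun i => (lam i)%:Z].

Definition skew_schur (R : comNzRingType) n (nu rho : gpar n) : fps R :=
  \det (\matrix_(i < n, j < n) hsym R (nu i - rho j - i%:Z + j%:Z)).

(* Formal Z-linear combinations of parameters: [inl k] stands for alpha_k and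
   [inr k] for beta_k. *)

Definition param : choiceType := (nat + nat)%type.

Definition Asum (k : nat) : {malg int[param]} := \sum_(i < k) << (inl (i : nat) : param) >>.

Definition Bsum (k : nat) : {malg int[param]} := \sum_(i < k) << (inr (i : nat) : param) >>.

Section Plethysm.
Variables (R : comNzRingType) (alpha beta : nat -> R).

Definition param_val (u : param) : R :=
  match u with inl k => alpha k | inr k => beta k end.

(* (1 - x t)^(-c), with 1 / (1 - x t) truncated after t^m; the truncation does
   not affect coefficients of t^k with k <= m. *)
Definition geom_pow (m : nat) (x : R) (c : int) : {poly R} :=
  match c with
  | Posz k => (\poly_(i < m.+1) x ^+ i) ^+ k
  | Negz k => (1 - x *: 'X) ^+ k.+1
  end.

Lemma geom_pow_inv (m : nat) (x : R) :
  (1 - x *: 'X) * geom_pow m x 1%:Z = 1 - x ^+ m.+1 *: 'X^(m.+1).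
Proof.
rewrite /geom_pow expr1 poly_def.
under eq_bigr do rewrite -exprZn.
by rewrite -exprZn -[RHS]opprB subrX1 -mulNr opprB.
Qed.

(* h_m[Z], the coefficient of t^m in prod_u (1 - u t)^(- c_u) *)
Definition hpleth (m : int) (Z : {malg int[param]}) : R :=
  match m with
  | Posz k => (\prod_(u <- msupp Z) geom_pow k (param_val u) Z@_u)`_k
  | Negz _ => 0
  end.

Definition coefC n (lam : {ffun 'I_n -> nat}) (nu : gpar n) : R :=
  \det (\matrix_(i < n, j < n)
    hpleth (nu i - (lam j)%:Z - i%:Z + j%:Z) (Asum (lam j) - Bsum j)).

Definition coefC' n (rho : gpar n) (mu : {ffun 'I_n -> nat}) : R :=
  \det (\matrix_(i < n, j < n)
    hpleth ((mu i)%:Z - rho j - i%:Z + j%:Z) (- Asum (mu i) + Bsum i.+1)).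

End Plethysm.

(* Marked multisets: the weakly increasing sequence of the elements, each with
   a boolean telling whether it is marked. The first element, and any element
   equal to its predecessor, must be unmarked. *)

Definition mmset : Type := seq (nat * bool).

HB.instance Definition _ := Choice.on mmset.

Definition is_mmset (s : mmset) : bool :=
  if s is a :: s' then
    ~~ a.2 && path (fun a b => (a.1 <= b.1)%N && (b.2 ==> (a.1 < b.1)%N)) a s'
  else false.

Definition mmin (s : mmset) : nat := (head (0%N, false) s).1.
Definition mmax (s : mmset) : nat := (last (0%N, false) s).1.
Definition nmarked (s : mmset) : nat := count (fun a => a.2) s.
Definition nunmarked (s : mmset) : nat := count (fun a => ~~ a.2) s.

Section Tableaux.
Variables (n : nat) (lam mu : {ffun 'I_n -> nat}).

(* The cell [Tagged _ k] of row i lies in column mu_i + k. *)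
Definition skew_cell : finType := {i : 'I_n & 'I_(lam i - mu i)}.

Definition cell_row (c : skew_cell) : nat := tag c.
Definition cell_col (c : skew_cell) : nat := (mu (tag c) + tagged c)%N.

Definition filling : choiceType := {ffun skew_cell -> mmset}.

Definition is_tableau (T : filling) : Prop :=
  [/\ forall c, is_mmset (T c),
      forall c d, cell_row d = cell_row c -> cell_col d = (cell_col c).+1 ->
        (mmax (T c) <= mmin (T d))%N
    & forall c d, cell_row d = (cell_row c).+1 -> cell_col d = cell_col c ->
        (mmax (T c) < mmin (T d))%N].

Variables (R : comNzRingType) (alpha beta : nat -> R).

Definition wt (T : filling) : fps R :=
  \prod_(c : skew_cell)
    ((\prod_(a <- T c) fpsX R a.1) *
     fpsC (alpha (cell_col c) ^+ (nunmarked (T c)).-1 *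
           (- beta (cell_row c)) ^+ nmarked (T c))).

Definition Gskew : fps R := fps_sum [set T | is_tableau T] wt.

End Tableaux.

Definition Cfactor (R : comNzRingType) (n : nat) (beta : nat -> R) : fps R :=
  \prod_(i < n) fps_prod (fun l => 1 - fpsC (beta i) * fpsX R l).

Section Expansion.
Variables (R : comNzRingType) (n : nat) (alpha beta : nat -> R).
Variables (lam mu : {ffun 'I_n -> nat}).

(* The pairs (rho, nu). *)
Definition expansion_index : set (gpar n * gpar n) :=
  [set p | [/\ is_gpar p.1 /\ is_gpar p.2, gsub p.1 (gpar_of_part mu),
      gsub (gpar_of_part mu) (gpar_of_part lam) & gsub (gpar_of_part lam) p.2]].

Definition expansion_term (p : gpar n * gpar n) : fps R :=
  fpsC (coefC alpha beta lam p.2) * skew_schur R p.2 p.1 *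
  fpsC (coefC' alpha beta p.1 mu).

End Expansion.

(* Main.v *)
(** Both sides are computed for tableaux with entries x_0, ..., x_(L-1).

    Peeling the last element off the last cell of row i, the generating
    function g(lam, i) of tableaux whose entries are at most L in the rows >= i
    and less than L in the rows < i satisfies, with x = x_L and c = lam_i - 1,
      (1 - alpha_c x) g(lam, i) = (1 - beta_i x) g(lam, i+1) + x g(lam - e_i, i)
    when row i can be shortened, and g(lam, i) = g(lam, i+1) otherwise.

    The Jacobi-Trudi determinant with entries
      sum_e h_e(x) h_(e + mu_j - j - lam_i + i)[A_(lam_i) - B_i - A_(mu_j) + B_(j+1)]
    satisfies the same recursion: the first equation by linearity in row i, the
    second because the determinant that measures the difference has two equal
    rows or a large zero block. Hence the two agree. In each degree the matrix
    of the determinant factors through a finite window of Z, and the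
    Cauchy-Binet formula expands it into the stated sum. *)

Require Import Defs.
From HB Require Import structures.
From mathcomp Require Import all_boot all_order all_algebra all_fingroup finmap.
From mathcomp Require Import boolp classical_sets functions cardinality fsbigop.
From mathcomp Require Import monalg zify ring.

Set Implicit Arguments.
Unset Strict Implicit.
Unset Printing Implicit Defensive.

Import Order.TTheory GRing.Theory Num.Theory.

Local Open Scope classical_set_scope.
Local Open Scope ring_scope.

(** * Determinants *)

(** The recursion ends because [L] increases, [i] descends from [n] to 0 within each [L], and
    [lam_i] descends within each [i]; stage ([L + 1], [n]) is stage ([L], 0). The first equation has
    the unknown on both sides, so [1 - alpha_c x] must be cancelled over a ring that may have zero
    divisors; its constant term 1 makes this possible. Row [k] may use the first [L + (i <= k)]
    variables. The factor [C] is cut down row by row in the same way; this puts [1 - beta_i x] into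
    the first equation and turns the second one into an identity between bare determinants. The
    alphabet of an entry splits into a part that depends only on the row, [A_(lam_i) - B_i], and a
    part that depends only on the column. The convolution formula for [h[Z + Z']] therefore factors
    the matrix. A skew Schur function is homogeneous of degree [|nu| - |rho|], so the containments
    leave finitely many pairs in each degree. Conversely, Cauchy-Binet runs over all pairs in the
    window, and those that violate a containment have a vanishing coefficient. *)

Section Determinants.
Local Open Scope set_scope.
Variable R : comNzRingType.

(** Pigeonhole: to avoid the block, a permutation would have to inject the [n - i] rows from [i] on
    into the [n - i - 1] columns beyond [i]. *)
Lemma det_zero_block n (A : 'M[R]_n) (i : 'I_n) :
  (forall k j : 'I_n, (i <= k)%N -> (j <= i)%N -> A k j = 0) -> \det A = 0.
Proof.
move=> A0; apply: big1 => s _.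
have [k ik ski] : exists2 k : 'I_n, (i <= k)%N & (s k <= i)%N.
  apply: contrapT => H.
  have sub : [set s k | k in [set k : 'I_n | (i <= k)%N]] \subset
             [set j : 'I_n | (i < j)%N].
    apply/fintype.subsetP => _ /imsetP[k + ->]; rewrite !inE => ik.
    by rewrite ltnNge; apply/negP => ski; apply: H; exists k.
  have := subset_leq_card sub; rewrite card_imset; last exact: perm_inj.
  rewrite leqNgt => /negP; apply; apply: proper_card; apply/fintype.properP; split.
    by apply/fintype.subsetP => j; rewrite !inE => /ltnW.
  by exists i; rewrite inE ?ltnn.
by rewrite (bigD1 k) //= A0 // mul0r mulr0.
Qed.

(** Selections are listed in decreasing order because the sequences [nu_i - i] of a generalized
    partition are strictly decreasing. *)
Definition decr n N (f : {ffun 'I_n -> 'I_N}) : bool :=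
  [forall i : 'I_n, forall j : 'I_n, (i < j)%N ==> (f j < f i)%N].

Lemma decrP n N (f : {ffun 'I_n -> 'I_N}) :
  reflect (forall i j : 'I_n, (i < j)%N -> (f j < f i)%N) (decr f).
Proof.
apply: (iffP forallP) => H i; first by move=> j; move/forallP/(_ j)/implyP: (H i).
by apply/forallP => j; apply/implyP; exact: H.
Qed.

Section Sort.
Variables (n N : nat).
Implicit Types f g : {ffun 'I_n -> 'I_N}.

Lemma rank_subproof f (k : 'I_n) : (#|[set l : 'I_n | (f k < f l)%N]| < n)%N.
Proof.
rewrite -[X in (_ < X)%N]card_ord -cardsT; apply/proper_card/fintype.properP; split.
  exact: finset.subsetT.
by exists k; rewrite inE ?ltnn.
Qed.

(** For injective [f], the position of [f k] in the decreasing list of values. *)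
Definition rank f k : 'I_n := Ordinal (rank_subproof f k).

Lemma rank_lt f k l : (f k < f l)%N -> (rank f l < rank f k)%N.
Proof.
move=> kl; apply/proper_card/fintype.properP; split.
  by apply/fintype.subsetP => p; rewrite !inE; exact: ltn_trans.
by exists l; rewrite !inE ?ltnn.
Qed.

Lemma rank_inj f : injective f -> injective (rank f).
Proof.
move=> fi k l kl; apply: fi; apply/val_inj.
by case: (ltngtP (f k) (f l)) => // /rank_lt; rewrite kl ltnn.
Qed.

Definition sortp f : 'S_n := odflt 1%g [pick s : 'S_n | [forall k, s k == rank f k]].

Lemma sortpE f : injective f -> sortp f =1 rank f.
Proof.
move=> fi k; rewrite /sortp; case: pickP => [s /forallP/(_ k)/eqP //|].
move/(_ (perm (rank_inj fi)))/negP; case; apply/forallP => l.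
by rewrite permE.
Qed.

Lemma decr_inj g : decr g -> injective g.
Proof.
move=> /decrP gd k l kl; apply/val_inj.
by case: (ltngtP k l) => // /gd; rewrite kl ltnn.
Qed.

Lemma rank_decr g (s : 'S_n) k : decr g -> rank [ffun i => g (s i)] k = s k.
Proof.
move=> gd; apply/val_inj => /=.
have -> : [set l : 'I_n | ([ffun i => g (s i)] k < [ffun i => g (s i)] l)%N] =
          s @^-1: [set l : 'I_n | (l < s k)%N].
  apply/finset.setP => l; rewrite !inE !ffunE.
  have /decrP gd' := gd.
  case: (ltngtP (s l) (s k)) => [/gd' //|/gd'|/val_inj ->]; last by rewrite ltnn.
  by move/ltnW; rewrite leqNgt => /negPf.
rewrite card_preimset; last exact: perm_inj.
rewrite -sum1_card; under eq_bigl do rewrite inE.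
rewrite -(big_mkord (fun l => (l < s k)%N) (fun=> 1%N)).
rewrite (big_cat_nat (n := s k)) ?leq0n //=; last exact: ltnW.
rewrite [X in (_ + X)%N]big_nat_cond [X in (_ + X)%N]big1 => [|l]; last first.
  by case/andP=> /andP[h1 _] h2; move: h1 h2; lia.
rewrite big_nat_cond (eq_bigl (fun l => (0 <= l < s k)%N)) => [|l]; last lia.
by rewrite -big_nat sum_nat_const_nat; lia.
Qed.

Lemma sort_decr f : injective f -> decr [ffun i => f ((sortp f)^-1%g i)].
Proof.
move=> fi; apply/decrP => i j ij; rewrite !ffunE.
set s := sortp f; rewrite ltnNge leq_eqVlt; apply/negP => /orP[/eqP/val_inj/fi|].
  by move/perm_inj => E; rewrite E ltnn in ij.
by move/rank_lt; rewrite -!sortpE // !permKV; move: ij; lia.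
Qed.

End Sort.

(** Expanding every row of the product gives a sum over all maps [f]. A repeated value selects two
    equal rows of [B]; an injective map is uniquely a decreasing map composed with a permutation,
    whose sign assembles the minor of [A]. *)
Lemma Cauchy_Binet n N (A : 'M[R]_(n, N)) (B : 'M[R]_(N, n)) :
  \det (A *m B) = \sum_(f : {ffun 'I_n -> 'I_N} | decr f)
     \det (colsub f A) * \det (rowsub f B).
Proof.
pose F := {ffun 'I_n -> 'I_N}.
transitivity (\sum_(f : F) (\prod_i A i (f i)) * \det (rowsub f B)).
  rewrite /determinant; under [RHS]eq_bigr do rewrite mulr_sumr.
  rewrite exchange_big; apply: eq_bigr => /= s _.
  under eq_bigr do rewrite mxE.
  rewrite (bigA_distr_bigA (fun i k => A i k * B k (s i))) /= mulr_sumr.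
  apply: eq_bigr => f _; rewrite big_split /= mulrCA; congr (_ * (_ * _)).
  by apply: eq_bigr => i _; rewrite mxE.
rewrite (bigID (fun f : F => injectiveb f)) /= [X in _ + X]big1 ?addr0; last first.
  move=> f /injectivePn[i [j ij fij]].
  by rewrite (determinant_alternate ij) ?mulr0 // => k; rewrite !mxE fij.
transitivity (\sum_(f : F | decr f) \sum_(s : 'S_n)
    (\prod_i A i (f (s i))) * \det (rowsub [ffun i => f (s i)] B)).
  rewrite pair_big /=.
  (* [h] and [h'] are inverse bijections between pairs with decreasing first component and injective
     maps. *)
  pose h (p : F * 'S_n) : F := [ffun i => p.1 (p.2 i)].
  pose h' (f : F) : F * 'S_n := ([ffun i => f ((sortp f)^-1%g i)], sortp f).
  rewrite (reindex_onto h h') /=; last first.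
    by move=> f fi; apply/ffunP => i; rewrite !ffunE permK.
  apply: eq_big => [[g s]|[g s] _] /=; last first.
    by congr (_ * _); apply: eq_bigr => i _; rewrite ffunE.
  rewrite andbT; apply/andP/idP => [[/injectiveP hi /eqP[<- _]]|gd]; first exact: sort_decr.
  have hi : injective (h (g, s)).
    by move=> i j; rewrite !ffunE => /(decr_inj gd)/perm_inj.
  split; first exact/injectiveP.
  have E : sortp (h (g, s)) = s by apply/permP => k; rewrite sortpE // rank_decr.
  rewrite /h' E; apply/eqP; congr (_, _).
  by apply/ffunP => k; rewrite !ffunE /= permKV.
apply: eq_bigr => f _; rewrite [\det (colsub _ _)]/determinant mulr_suml; apply: eq_bigr => s _.
have -> : rowsub [ffun i => f (s i)] B = row_perm s (rowsub f B).
  by apply/matrixP => i j; rewrite !mxE ffunE.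
rewrite row_permE det_mulmx det_perm mulrCA mulrA; congr (_ * _ * _).
by apply: eq_bigr => i _; rewrite mxE.
Qed.

End Determinants.

(** * Plethystic complete symmetric functions *)

Section TruncatedPolynomials.
Variables (R : comNzRingType) (N : nat).
Implicit Types p q : {poly R}.

(** Equality modulo [t^(N+1)]: [geom_pow] truncates the geometric series, so laws of exponents hold
    only in this sense. *)
Definition eqX p q := forall j, (j <= N)%N -> p`_j = q`_j.

Lemma eqXM p p' q q' : eqX p p' -> eqX q q' -> eqX (p * q) (p' * q').
Proof.
move=> pp qq j jN; rewrite !coefM; apply: eq_bigr => i _.
have iN : (i <= N)%N by rewrite (leq_trans _ jN) // -ltnS ltn_ord.
by rewrite pp // qq // (leq_trans _ jN) // leq_subr.
Qed.

Lemma eqXX p p' k : eqX p p' -> eqX (p ^+ k) (p' ^+ k).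
Proof. by move=> pp; elim: k => // k IHk; rewrite !exprS; exact: eqXM. Qed.

Lemma eqX_prod (I : Type) (r : seq I) (F G : I -> {poly R}) :
  (forall i, eqX (F i) (G i)) -> eqX (\prod_(i <- r) F i) (\prod_(i <- r) G i).
Proof. by move=> FG; apply: (big_ind2 eqX) => // p p' q q'; exact: eqXM. Qed.

(** The two bases are inverse to each other modulo [t^(N+1)], so only the difference of the
    exponents matters. This reduces [geom_powD] to exponents in [nat]. *)
Lemma geom_pow_sub x a b :
  eqX (geom_pow N x (a%:Z - b%:Z))
      ((\poly_(i < N.+1) x ^+ i) ^+ a * (1 - x *: 'X) ^+ b).
Proof.
set P := \poly_(i < _) _; set Q := 1 - _ *: _.
have QP : eqX (P * Q) 1.
  move=> j jN; have := geom_pow_inv N x; rewrite /geom_pow expr1 mulrC => ->.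
  rewrite coefB coefZ coefXn.
  have -> : (j == N.+1) = false by move: jN; lia.
  by rewrite mulr0 subr0.
have PQ k : eqX 1 (P ^+ k * Q ^+ k).
  by rewrite -exprMn => j jN; rewrite (eqXX k QP jN) expr1n.
have [ba|ab] := leqP b a.
  have -> : a%:Z - b%:Z = (a - b)%N by lia.
  rewrite [in X in eqX _ X](_ : a = (a - b) + b)%N; last lia.
  rewrite exprD -mulrA -[X in eqX X _]mulr1.
  by apply: eqXM => //; exact: PQ.
have -> : a%:Z - b%:Z = Negz (b - a).-1 by lia.
rewrite /geom_pow [in X in eqX _ X](_ : b = a + (b - a).-1.+1)%N; last lia.
rewrite exprD mulrA -[X in eqX X _]mul1r.
by apply: eqXM => //; exact: PQ.
Qed.

Lemma geom_powD x c d :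
  eqX (geom_pow N x (c + d)) (geom_pow N x c * geom_pow N x d).
Proof.
have dec (e : int) : exists a b : nat, e = a%:Z - b%:Z.
  by case: e => k; [exists k, 0%N | exists 0%N, k.+1]; lia.
have [[a [b ->]] [a' [b' ->]]] := (dec c, dec d).
have -> : a%:Z - b%:Z + (a'%:Z - b'%:Z) = (a + a')%N%:Z - (b + b')%N%:Z by lia.
move=> j jN; rewrite (eqXM (geom_pow_sub x a b) (geom_pow_sub x a' b')) //.
by rewrite geom_pow_sub // !exprD mulrACA.
Qed.

End TruncatedPolynomials.

Lemma geom_pow_widen (R : comNzRingType) k N (x : R) c : (k <= N)%N ->
  eqX k (geom_pow N x c) (geom_pow k x c).
Proof.
move=> kN; case: c => c //=; apply: eqXX => j jk; rewrite !coef_poly !ltnS jk.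
by rewrite (leq_trans jk).
Qed.

Arguments hpleth : simpl never.

Section HPleth.
Variables (R : comNzRingType) (alpha beta : nat -> R).
Implicit Types (Z : {malg int[param]}) (u : param) (k : int).
Local Notation val := (param_val alpha beta).
Local Notation hp := (hpleth alpha beta).

(** [hpleth] truncates at the very index that it reads, whereas a product of series needs one order
    [N] and, through [genfE], one common index set of parameters. *)
Let genf N Z : {poly R} := \prod_(u <- msupp Z) geom_pow N (val u) Z@_u.

Let genfE N Z (D : {fset param}) : (msupp Z `<=` D)%fset ->
  genf N Z = \prod_(u <- D) geom_pow N (val u) Z@_u.
Proof.
by move=> ZD; apply: big_fset_incl => // u _ /mcoeff_outdom ->.
Qed.

Let hp_genf N (i : nat) Z : (i <= N)%N -> hp i Z = (genf N Z)`_i.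
Proof.
move=> iN; apply/esym.
exact: (eqX_prod (msupp Z) (fun u => geom_pow_widen (val u) Z@_u iN) (leqnn i)).
Qed.

Lemma hplethD (m : nat) Z Z' :
  hp m (Z + Z') = \sum_(i < m.+1) hp i Z * hp (m - i)%N Z'.
Proof.
pose D := (msupp (Z + Z') `|` (msupp Z `|` msupp Z'))%fset.
rewrite (hp_genf _ (leqnn m)) (@genfE _ _ D); last exact: fsubsetUl.
under eq_bigr do rewrite mcoeffD.
rewrite (eqX_prod D (fun u => geom_powD (val u) Z@_u Z'@_u) (leqnn m)).
rewrite big_split /= -!genfE ?coefM; last 2 first.
- by rewrite /D fsetUA fsubsetUr.
- by rewrite /D fsetUCA fsubsetUl.
apply: eq_bigr => i _; rewrite -!hp_genf ?leq_subr //.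
by rewrite -ltnS ltn_ord.
Qed.

Lemma hpleth0 k : hp k 0 = (k == 0)%:R.
Proof. by case: k => // k; rewrite /hpleth msupp0 big_seq_fset0 coef1. Qed.

Lemma hpleth_lt0 k Z : k < 0 -> hp k Z = 0.
Proof. by case: k. Qed.

Let hp_opp1 (i : nat) u :
  hp i (- << u >>) = (i == 0%N)%:R - (i == 1%N)%:R * val u.
Proof.
rewrite /hpleth -/(genf i _) (@genfE _ _ [fset u]%fset); last first.
  rewrite msuppN; exact: msuppU_le.
rewrite big_seq_fset1 mcoeffN mcoeffU eqxx /geom_pow /=.
by rewrite coefB coef1 coefZ coefX mulrC.
Qed.

(** Subtracting the letter [u] multiplies the generating series by [1 - u t]. *)
Lemma hpleth_sub1 k Z u :
  hp k (Z - << u >>) = hp k Z - val u * hp (k - 1) Z.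
Proof.
case: k => [[|m]|m]; last by rewrite !hpleth_lt0 ?mulr0 ?subr0 //; lia.
  rewrite [hp (_ - 1) _]hpleth_lt0 // mulr0 subr0.
  by rewrite hplethD big_ord1 hp_opp1 mul0r subr0 mulr1.
have -> : m.+1%:Z - 1 = m by lia.
rewrite hplethD 2!big_ord_recr big1 ?add0r; last first.
  case=> i im _; rewrite hp_opp1 /=.
  have -> : (m.+1 - i == 0)%N = false by lia.
  have -> : (m.+1 - i == 1)%N = false by lia.
  by rewrite mul0r subr0 mulr0.
by rewrite !hp_opp1 /= subnn subSnn !mul0r !mul1r sub0r subr0 mulr1 addrC mulrN mulrC sub0r.
Qed.

(** Up to sign [h_k[-X]] is the elementary symmetric function [e_k(X)], which is zero once [k]
    exceeds the number of letters. *)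
Lemma hpleth_opp (s : seq param) k : (size s)%:Z < k ->
  hp k (- \sum_(u <- s) << u >>) = 0.
Proof.
elim: s k => [|u s IHs] k sk.
  by rewrite big_nil oppr0 hpleth0; case: eqP sk => // ->.
rewrite big_cons opprD addrC hpleth_sub1 !IHs ?mulr0 ?subr0 //; move: sk => /=; lia.
Qed.

End HPleth.

(** * Coefficients of power series *)

Section FpsCoef.
Variable R : comNzRingType.
Implicit Types (f g : fps R) (m a b : mon) (w : nat -> R).

Lemma fcoefD f g m : fcoef (f + g) m = fcoef f m + fcoef g m.
Proof. by []. Qed.

Lemma fcoefN f m : fcoef (- f) m = - fcoef f m.
Proof. by []. Qed.

Lemma fcoef_sum (I : Type) (r : seq I) (P : pred I) (F : I -> fps R) m :
  fcoef (\sum_(i <- r | P i) F i) m = \sum_(i <- r | P i) fcoef (F i) m.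
Proof. by elim/big_rec2: _ => // i y1 y2 _ <-. Qed.

Lemma fcoef_monM (b : mon) (c : R) f g m :
    (forall a, fcoef g a = if a == b then c else 0) ->
  fcoef (g * f) m = if b \in mdivs m then c * fcoef f (divcm m b) else 0.
Proof.
move=> gE; rewrite fcoefM; case: ifPn => bm.
  rewrite (big_fsetD1 b) //= gE eqxx big1_fset ?addr0 // => a.
  by rewrite !inE gE => /andP[/negPf -> _]; rewrite mul0r.
rewrite big1_seq // => a /andP[_ am]; rewrite gE.
by case: eqP => [ab|]; rewrite ?mul0r //; rewrite -ab am in bm.
Qed.

Lemma fcoef_CM c f m : fcoef (fpsC c * f) m = c * fcoef f m.
Proof.
rewrite (@fcoef_monM mone c) //.
have -> : mone \in mdivs m by apply/in_mdivs => i; rewrite cm1.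
congr (_ * fcoef f _); apply/eqP/cmP => i.
by rewrite divcmE cm1 subn0.
Qed.

Lemma ucm_mdivs k m : (ucm k \in mdivs m) = (0 < m k)%N.
Proof.
apply/in_mdivs/idP => [/(_ k)|mk i]; rewrite ucmE; first by rewrite eqxx.
by case: eqP => // <-.
Qed.

Lemma fcoef_XM k f m :
  fcoef (fpsX R k * f) m = if (0 < m k)%N then fcoef f (divcm m (ucm k)) else 0.
Proof.
rewrite (@fcoef_monM (ucm k) 1) ?ucm_mdivs ?mul1r // => a /=.
by case: eqP.
Qed.

Lemma divcmK m k : (0 < m k)%N -> mmul (ucm k) (divcm m (ucm k)) = m.
Proof. by move=> mk; apply/eqP; rewrite divcmP ucm_mdivs mk eqxx. Qed.

Lemma mdeg_divX m k : (0 < m k)%N -> mdeg m = (mdeg (divcm m (ucm k))).+1.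
Proof. by move=> /divcmK {1}<-; rewrite mdegM mdegU. Qed.

Lemma fpsC1 : fpsC 1 = 1 :> fps R.
Proof. by apply: fpsP => m /=; case: eqP. Qed.

Lemma fpsCM c d : fpsC (c * d) = fpsC c * fpsC d :> fps R.
Proof.
by apply: fpsP => m; rewrite fcoef_CM /=; case: ifP; rewrite ?mulr0.
Qed.

Lemma fpsCN c : fpsC (- c) = - fpsC c :> fps R.
Proof. by apply: fpsP => m /=; case: ifP; rewrite ?oppr0. Qed.

Lemma fpsC_prod (I : Type) (r : seq I) (F : I -> R) :
  fpsC (\prod_(i <- r) F i) = \prod_(i <- r) fpsC (F i).
Proof. by elim/big_rec2: _ => [|i y1 y2 _ <-]; [exact: fpsC1|exact: fpsCM]. Qed.

(** Induction on the degree: the coefficient of [f] at [m] is [c] times the one at [m / x_k], or 0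
    if [x_k] does not divide [m]. *)
Lemma mul_oneBX_inj c k f : (1 - fpsC c * fpsX R k) * f = 0 -> f = 0.
Proof.
move=> f0; apply: fpsP => m /=.
elim: {m}(mdeg m).+1 {-2}m (ltnSn (mdeg m)) => // d IHd m; rewrite ltnS => md.
have : fcoef ((1 - fpsC c * fpsX R k) * f) m = 0 by rewrite f0.
rewrite mulrBl mul1r fcoefB -mulrA fcoef_CM fcoef_XM.
case: ifP => mk; last by rewrite mulr0 subr0.
rewrite [fcoef f (divcm _ _)]IHd ?mulr0 ?subr0 //.
by move: md; rewrite (mdeg_divX mk).
Qed.

Definition supp_lt L m : bool := all (fun i => (i < L)%N) (finsupp m).

Lemma supp_ltP L m : reflect (forall i, (L <= i)%N -> m i = 0%N) (supp_lt L m).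
Proof.
apply: (iffP allP) => H i; last first.
  by apply: contraTT; rewrite -leqNgt => /H mi; rewrite -cmE_eq0 mi.
move=> Li; apply/eqP; rewrite cmE_eq0; apply/negP => /H; rewrite ltnNge Li //.
Qed.

(* [gser L w] is the sum of [w e * h_e(x_0, ..., x_(L-1))] over e. *)
Definition gser L w : fps R := FPS (fun m => if supp_lt L m then w (mdeg m) else 0).

(** Monomials are separated by whether [x_L] divides them. *)
Lemma gserS L w :
  gser L.+1 w = gser L w + fpsX R L * gser L.+1 (fun e => w e.+1).
Proof.
apply: fpsP => m; rewrite fcoefD fcoef_XM /=.
case: (posnP (m L)) => [mL|mL].
  rewrite addr0; congr (if _ then _ else _); apply/supp_ltP/supp_ltP => H i Li.
    by move: Li; rewrite leq_eqVlt => /orP[/eqP <-|/H].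
  by apply: H; lia.
have -> : supp_lt L m = false.
  by apply/negP => /supp_ltP/(_ L (leqnn L)) mL0; rewrite mL0 in mL.
rewrite add0r -(mdeg_divX mL); congr (if _ then _ else _).
apply/supp_ltP/supp_ltP => H i Li; have := H i Li; rewrite divcmE ucmE.
  by move=> ->.
by case: eqP Li => [->|_]; rewrite ?ltnn ?subn0.
Qed.

Lemma gser_step L c w w' : (forall e, w' e = w e.+1 - c * w e) ->
  (1 - fpsC c * fpsX R L) * gser L.+1 w = gser L w + fpsX R L * gser L.+1 w'.
Proof.
move=> ww.
have -> : gser L.+1 w' = gser L.+1 (fun e => w e.+1) - fpsC c * gser L.+1 w.
  apply: fpsP => m; rewrite fcoefB fcoef_CM /= ww.
  by case: ifP; rewrite // mulr0 subr0.
have -> : gser L w = gser L.+1 w - fpsX R L * gser L.+1 (fun e => w e.+1).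
  by rewrite [in RHS]gserS addrK.
by ring.
Qed.

Lemma gser0 w : (forall e, w e = 0) -> forall L, gser L w = 0.
Proof. by move=> w0 L; apply: fpsP => m /=; rewrite w0 if_same. Qed.

Lemma gser_L0 w : gser 0 w = fpsC (w 0%N).
Proof.
apply: fpsP => m /=; have -> : supp_lt 0 m = (m == mone).
  apply/supp_ltP/idP => [H|/eqP -> i _]; last by rewrite cm1.
  by apply/cmP => i; rewrite cm1 H.
by case: eqP => // ->; rewrite mdeg1.
Qed.

(* Congruence modulo the monomials that do not divide m. *)
Definition eqmod m f g := forall a, a \in mdivs m -> fcoef f a = fcoef g a.

Lemma mdivs_id m : m \in mdivs m. Proof. exact/in_mdivs. Qed.

Lemma eqmod_refl m f : eqmod m f f. Proof. by []. Qed.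

Lemma eqmod_add m f f' g g' : eqmod m f f' -> eqmod m g g' -> eqmod m (f + g) (f' + g').
Proof. by move=> ff gg a am; rewrite !fcoefD ff // gg. Qed.

Lemma eqmod_mul m f f' g g' : eqmod m f f' -> eqmod m g g' -> eqmod m (f * g) (f' * g').
Proof.
move=> ff gg a /in_mdivs am; rewrite !fcoefM; apply: eq_big_seq => b /in_mdivs ba.
rewrite ff ?gg //; apply/in_mdivs => i; last exact: leq_trans (am i).
by rewrite divcmE (leq_trans (leq_subr _ _)).
Qed.

Lemma eqmod_prod m (I : Type) (r : seq I) (F G : I -> fps R) :
  (forall i, eqmod m (F i) (G i)) -> eqmod m (\prod_(i <- r) F i) (\prod_(i <- r) G i).
Proof.
move=> FG; apply: (big_ind2 (eqmod m)) => // f f' g g'; exact: eqmod_mul.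
Qed.

Lemma eqmod_det m n (A B : 'M[fps R]_n) :
  (forall i j, eqmod m (A i j) (B i j)) -> eqmod m (\det A) (\det B).
Proof.
move=> AB; apply: (big_ind2 (eqmod m)); first exact: eqmod_refl.
  by move=> f f' g g'; exact: eqmod_add.
by move=> s _; apply: eqmod_mul; [exact: eqmod_refl|exact: eqmod_prod].
Qed.

End FpsCoef.

(** * The Jacobi-Trudi determinant *)

(* Otherwise unification unfolds the ring operations of [fps R]. *)
Opaque fps_add fps_mul fps_opp fps0 fps1.

Lemma det_row_linear (S : comNzRingType) n (A B C : 'M[S]_n) i a b :
    (forall j, a * A i j = B i j + b * C i j) ->
    (forall k j, k != i -> B k j = A k j) -> (forall k j, k != i -> C k j = A k j) ->
  a * \det A = \det B + b * \det C.
Proof.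
move=> ABC BA CA; pose A' := \matrix_(k, j) (if k == i then a * A k j else A k j).
have row'P (M N : 'M_n) : (forall k j, k != i -> M k j = N k j) -> row' i M = row' i N.
  by move=> MN; apply/matrixP => k j; rewrite !mxE MN // eq_sym neq_lift.
have <- : \det A' = a * \det A.
  have := @determinant_multilinear _ _ A' A A i a 0.
  rewrite mul0r addr0; apply.
  - by rewrite scale0r addr0; apply/rowP => j; rewrite !mxE eqxx.
  - by apply: row'P => k j /negPf ki; rewrite !mxE ki.
  - by apply: row'P => k j /negPf ki; rewrite !mxE ki.
rewrite -[\det B]mul1r; apply: (@determinant_multilinear _ _ A' B C i).
- by apply/rowP => j; rewrite !mxE eqxx mul1r.
- by apply: row'P => k j ki; rewrite mxE (negPf ki) BA.
- by apply: row'P => k j ki; rewrite mxE (negPf ki) CA.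
Qed.

(** Only row [i] loses a variable when [i] becomes [i + 1], so [gser_step] passes to the
    determinant. It is used with an alpha, where [w'] describes a row shorter by one, and with a
    beta, where [w'] describes a row of the next index. *)
Lemma det_gser_step (R : comNzRingType) n L (i : 'I_n) (c : R)
    (w : 'I_n -> 'I_n -> nat -> R) (w' : 'I_n -> nat -> R) :
    (forall j e, w' j e = w i j e.+1 - c * w i j e) ->
  (1 - fpsC c * fpsX R L) * \det (\matrix_(k, j) gser (L + (i <= k)) (w k j)) =
  \det (\matrix_(k, j) gser (L + (i.+1 <= k)) (w k j)) +
  fpsX R L *
    \det (\matrix_(k, j) gser (L + (i <= k)) (if k == i then w' j else w k j)).
Proof.
move=> ww; apply: (@det_row_linear _ _ _ _ _ i) => [j|k j ki|k j ki]; rewrite !mxE.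
- by rewrite eqxx leqnn ltnn addn0 addn1; exact: gser_step.
- by rewrite ltn_neqAle eq_sym (inj_eq val_inj) ki.
- by rewrite (negPf ki).
Qed.

(* [ring] does not apply: [{malg int[param]}] is not a ring. *)
Ltac malg_ring := apply/malgP => ?; rewrite ?(mcoeffD, mcoeffN); ring.

Lemma AsumS k : Asum k.+1 = Asum k + << (inl k : param) >>.
Proof. by rewrite /Asum big_ord_recr. Qed.

Lemma BsumS k : Bsum k.+1 = Bsum k + << (inr k : param) >>.
Proof. by rewrite /Bsum big_ord_recr. Qed.

Section JacobiTrudi.
Variables (R : comNzRingType) (n : nat) (alpha beta : nat -> R) (mu : nat -> nat).
Hypothesis mu_decr : forall i j, (i <= j)%N -> (mu j <= mu i)%N.
Implicit Types lam : nat -> nat.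
Local Notation hp := (hpleth alpha beta).

(** The coefficient of [h_e] in column [j] of a row of index [k] and length [c]. *)
Definition wco (k c j e : nat) : R :=
  hp (e%:Z + (mu j)%:Z - j%:Z - c%:Z + k%:Z)
     (Asum c - Bsum k + (- Asum (mu j) + Bsum j.+1)).

(** Shortening the row removes the letter [alpha c] from the alphabet, and the shift of [e] absorbs
    the change of degree. In [wco_row] the letter removed is [beta k]. *)
Lemma wco_col k c j e : wco k c j e = wco k c.+1 j e.+1 - alpha c * wco k c.+1 j e.
Proof.
rewrite /wco !AsumS; set Z := _ + (- Asum (mu j) + _).
rewrite (_ : Z = Asum c + << (inl c : param) >> - Bsum k
  + (- Asum (mu j) + Bsum j.+1) - << (inl c : param) >>); last by rewrite /Z; malg_ring.
by rewrite hpleth_sub1 /=; congr (hp _ _ - _ * hp _ _); lia.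
Qed.

Lemma wco_row k c j e : wco k.+1 c j e = wco k c j e.+1 - beta k * wco k c j e.
Proof.
rewrite /wco BsumS.
rewrite (_ : _ + _ = Asum c - Bsum k + (- Asum (mu j) + Bsum j.+1)
   - << (inr k : param) >>); last by malg_ring.
by rewrite hpleth_sub1 /=; congr (hp _ _ - _ * hp _ _); lia.
Qed.

(** The alphabet is minus a sum of [mu j - c + k - j - 1] letters, fewer than the degree. *)
Lemma wco_eq0 k c j e : (j < k)%N -> (c <= mu j)%N -> wco k c j e = 0.
Proof.
move=> jk cm; pose s : seq param :=
  [seq inl l | l <- index_iota c (mu j)] ++ [seq inr l | l <- index_iota j.+1 k].
rewrite /wco (_ : _ + _ = - \sum_(u <- s) << u >>).
  by apply: hpleth_opp; rewrite size_cat !size_map !size_iota; lia.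
rewrite /s big_cat !big_map /= /Asum /Bsum.
rewrite -(big_mkord xpredT (fun l => << (inl l : param) >>)).
rewrite -(big_mkord xpredT (fun l => << (inr l : param) >>)).
rewrite -(big_mkord xpredT (fun l => << (inl l : param) >>)).
rewrite -(big_mkord xpredT (fun l => << (inr l : param) >>)).
rewrite (@big_cat_nat _ _ _ c 0 (mu j)) //= (@big_cat_nat _ _ _ j.+1 0 k) //=.
by malg_ring.
Qed.

(** The finite form of [C]: row [k] has one factor for each variable that its entries may use. *)
Definition gpref L i : fps R :=
  \prod_(k < n) \prod_(l < L + (i <= k)) (1 - fpsC (beta k) * fpsX R l).

Definition gdet L i lam : fps R :=
  gpref L i * \det (\matrix_(k < n, j < n) gser (L + (i <= k)) (wco k (lam k) j)).

Lemma gprefS L i : (i < n)%N ->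
  gpref L i = (1 - fpsC (beta i) * fpsX R L) * gpref L i.+1.
Proof.
move=> ilt; rewrite /gpref (bigD1 (Ordinal ilt)) //= [in RHS](bigD1 (Ordinal ilt)) //=.
rewrite leqnn ltnn addn0 addn1 big_ord_recr /= mulrA [in LHS](mulrC (\prod_(l < L) _)).
congr (_ * _); apply: eq_bigr => k; rewrite -val_eqE /= => ki.
by rewrite [(i < k)%N]ltn_neqAle eq_sym ki.
Qed.

Definition upd (lam : nat -> nat) i c k := if k == i then c else lam k.

Lemma gdet_step L i lam c : (i < n)%N -> lam i = c.+1 ->
  (1 - fpsC (alpha c) * fpsX R L) * gdet L i lam =
  (1 - fpsC (beta i) * fpsX R L) * gdet L i.+1 lam +
  fpsX R L * gdet L i (upd lam i c).
Proof.
move=> ilt lc; pose io := Ordinal ilt.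
rewrite /gdet (gprefS L ilt) mulrCA.
rewrite (@det_gser_step _ _ _ io _ _ (fun j => wco i c j)) /=; last first.
  by move=> j e; rewrite lc; exact: wco_col.
rewrite [X in _ * (_ + _ * \det X)](_ : _ =
  \matrix_(k, j) gser (L + (i <= k)) (wco k (upd lam i c k) j)); first by ring.
apply/matrixP => k j; rewrite !mxE /upd; congr gser.
by rewrite -val_eqE /=; case: eqP => // ->.
Qed.

Lemma gdet_boundary L i lam : (i < n)%N ->
    (forall k l, (k <= l)%N -> (lam l <= lam k)%N) ->
    (lam i = lam i.+1 /\ (i.+1 < n)%N) \/ lam i = mu i ->
  gdet L i lam = gdet L i.+1 lam.
Proof.
move=> ilt lam_decr H; pose io := Ordinal ilt.
rewrite /gdet (gprefS L ilt) mulrAC [_ * gpref _ _]mulrC; congr (_ * _).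
(* With the prefactor cancelled, the claim is that multiplying by [1 - beta_i x_L] removes [x_L]
   from row [i]. The error term is the determinant whose row [i] has the coefficients
   [wco i.+1 (lam i)]. *)
rewrite (@det_gser_step _ _ _ io _ _ (fun j => wco i.+1 (lam i) j)) /=; last first.
  by move=> j e; exact: wco_row.
rewrite [X in _ * X](_ : _ = 0) ?mulr0 ?addr0 //.
case: H => [[ll i1]|lm].
  (* Row [i] of the error determinant coincides with row [i + 1]: equal lengths, equal index, and
     [L + 1] variables in both. *)
  pose i1o := Ordinal i1.
  have ii : io != i1o by rewrite -val_eqE /= ltn_eqF.
  apply: (determinant_alternate ii) => j; rewrite !mxE eqxx eq_sym (negPf ii) /= ll.
  by rewrite leqnn leqnSn.
(* In rows from [i] on and columns [j] up to [i], the row length is at most [mu i], hence at most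
   [mu j], and the row index exceeds [j]. *)
apply: (@det_zero_block _ _ _ io) => /= k j ik ji; rewrite mxE; apply: gser0 => e.
case: eqP => [_|/eqP ki].
  by apply: wco_eq0; rewrite ?ltnS // lm mu_decr.
have ik' : (i < k)%N by rewrite ltn_neqAle ik andbT eq_sym -(inj_eq val_inj) in ki *.
apply: wco_eq0; first lia.
by rewrite (leq_trans (lam_decr _ _ ik)) // lm mu_decr.
Qed.

(** Both stages allow the variables up to [x_L] in every row. *)
Lemma gdet_recL L lam : gdet L.+1 n lam = gdet L 0 lam.
Proof.
have E (k : 'I_n) : (L.+1 + (n <= k) = L + (0 <= k))%N.
  by rewrite leqNgt ltn_ord /=; lia.
rewrite /gdet /gpref; under eq_bigr do rewrite E.
by congr (_ * \det _); apply/matrixP => k j; rewrite !mxE E.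
Qed.

Lemma wco_lt0 k c j : (mu j)%:Z - j%:Z < c%:Z - k%:Z -> wco k c j 0 = 0.
Proof. by move=> H; apply: hpleth_lt0; move: H; lia. Qed.

(** The alphabet collapses to the letter [beta k] and the degree to 0. *)
Lemma wco_diag k : wco k (mu k) k 0 = 1.
Proof.
rewrite /wco BsumS.
set Z := (X in hp _ X); have -> : Z = << (inr k : param) >> by rewrite /Z; malg_ring.
have := hpleth_sub1 alpha beta 0 << (inr k : param) >> (inr k).
rewrite subrr hpleth0 eqxx (hpleth_lt0 _ _ _ (isT : 0 - 1 < 0 :> int)) mulr0 subr0 => H.
by rewrite (_ : _ - _ - _ + _ = 0) -?H //; lia.
Qed.

(** Without variables only [e = 0] survives. For [lam = mu] the matrix is triangular with unit
    diagonal; if [lam i > mu i], the degrees are negative in rows up to [i] and columns from [i]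
    on. *)
Lemma gdet_base lam : (forall k l, (k <= l)%N -> (lam l <= lam k)%N) ->
    (forall k, (mu k <= lam k)%N) ->
  gdet 0 n lam = ([forall k : 'I_n, lam k == mu k])%:R.
Proof.
move=> lam_decr mul; have nk (k : 'I_n) : (0 + (n <= k) = 0)%N by rewrite leqNgt ltn_ord.
rewrite /gdet /gpref big1 ?mul1r => [|k _]; last by rewrite nk big_ord0.
case: forallP => [H|/forallP/forallPn[i il]].
  rewrite det_trig; last first.
    apply/is_trig_mxP => k j kj; rewrite mxE nk gser_L0 wco_lt0.
      by apply: fpsP => m /=; rewrite if_same.
    have := mu_decr (ltnW kj); rewrite (eqP (H k)); lia.
  by rewrite big1 // => k _; rewrite mxE nk gser_L0 (eqP (H k)) wco_diag fpsC1.
rewrite -det_tr; apply: (@det_zero_block _ _ _ i) => k j ik ji; rewrite !mxE nk gser_L0.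
rewrite wco_lt0; first by apply: fpsP => m /=; rewrite if_same.
have := mu_decr ik; have := lam_decr _ _ ji; have := mul i; move: il; lia.
Qed.

End JacobiTrudi.

(** * Tableaux of varying shape *)

Section FpsSum.
Variables (R : comNzRingType) (I J : choiceType).
Implicit Types (A B : set I) (F G : I -> fps R).

Lemma fps_summable_sub A B F : A `<=` B -> fps_summable B F -> fps_summable A F.
Proof.
by move=> AB sB m; apply: sub_finite_set (sB m) => i [Ai Fi]; split=> //; apply: AB.
Qed.

Lemma fps_sum_eq A F G : (forall i, A i -> F i = G i) -> fps_sum A F = fps_sum A G.
Proof.
move=> FG; apply: fpsP => m; rewrite /fps_sum /=; apply: eq_fsbigr => i.
by rewrite inE => Ai; rewrite FG.
Qed.

Lemma fps_sumU A B F : fps_summable (A `|` B) F -> (forall i, A i -> B i -> False) ->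
  fps_sum (A `|` B) F = fps_sum A F + fps_sum B F.
Proof.
move=> sAB AB0; apply: fpsP => m; rewrite fcoefD /fps_sum /=.
rewrite fsbig_supp [X in _ = X + _]fsbig_supp [X in _ = _ + X]fsbig_supp setIUl.
have fin C : C `<=` A `|` B ->
    finite_set (C `&` (fun i => fcoef (F i) m) @^-1` [set~ 0]).
  move=> CAB; apply: sub_finite_set (sAB m) => i [Ci /eqP Fi].
  by split=> //; apply: CAB.
apply: fsbigU0.
- by apply: fin => i; left.
- by apply: fin => i; right.
- by move=> i [[Ai _] [Bi _]]; exact: AB0 Ai Bi.
Qed.

Lemma fps_sum_image A (h : I -> J) (F : J -> fps R) : set_inj A h ->
  fps_sum (h @` A) F = fps_sum A (F \o h).
Proof. by move=> hi; apply: fpsP => m; rewrite /fps_sum /= fsbig_image. Qed.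

Lemma fps_sumMl A F c k : fps_summable A F ->
  fps_sum A (fun i => fpsC c * fpsX R k * F i) = fpsC c * fpsX R k * fps_sum A F.
Proof.
move=> sF; apply: fpsP => m; rewrite -mulrA fcoef_CM fcoef_XM.
have E i : fcoef (fpsC c * fpsX R k * F i) m =
    c * (if (0 < m k)%N then fcoef (F i) (divcm m (ucm k)) else 0).
  by rewrite -mulrA fcoef_CM fcoef_XM.
transitivity (\sum_(i \in A)
    c * (if (0 < m k)%N then fcoef (F i) (divcm m (ucm k)) else 0)).
  by apply: eq_fsbigr => i _; exact: E.
case: ifP => _; last by rewrite mulr0 fsbig1 // => i _; rewrite mulr0.
rewrite full_fsbig_distrr //; apply: sub_finite_set (sF (divcm m (ucm k))) => i.
by move=> [Ai /eqP Fi].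
Qed.

End FpsSum.

Section MarkedMultisets.
Implicit Types (s : mmset) (v : nat) (b : bool).

Lemma mmax_rcons s a : mmax (rcons s a) = a.1.
Proof. by rewrite /mmax last_rcons. Qed.

Lemma mmin_rcons s a : mmin (rcons s a) = if s == [::] then a.1 else mmin s.
Proof. by case: s. Qed.

Lemma is_mmset_rcons s v b : s != [::] ->
  is_mmset (rcons s (v, b)) = [&& is_mmset s, (mmax s <= v)%N & b ==> (mmax s < v)%N].
Proof. by case: s => [|a s] //= _; rewrite rcons_path andbA. Qed.

Lemma is_mmset1 v b : is_mmset [:: (v, b)] = ~~ b.
Proof. by rewrite /= andbT. Qed.

Lemma mmin_le_mmax s : is_mmset s -> (mmin s <= mmax s)%N.
Proof.
elim/last_ind: s => [|s [v b] IHs] //.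
rewrite mmin_rcons mmax_rcons; case: eqP => // /eqP s0.
by rewrite is_mmset_rcons // => /and3P[/IHs h1 h2 _]; exact: leq_trans h2.
Qed.

Lemma nunmarked_gt0 s : is_mmset s -> (0 < nunmarked s)%N.
Proof. by case: s => [|a s] //= /andP[-> _]. Qed.

End MarkedMultisets.

Definition tab : choiceType := (nat -> nat -> mmset : choiceType).

Section Tab.
Variables (n : nat) (mu : nat -> nat).
Hypothesis mu_decr : forall i j, (i <= j)%N -> (mu j <= mu i)%N.
Implicit Types (lam : nat -> nat) (T : tab) (L i k j c : nat).

Definition inshape lam k j := (mu k <= j < lam k)%N.

(* [T] is empty exactly outside lam / mu, so the shape can vary while the type
   of tableaux is fixed. *)
Record is_tab lam L i T : Prop := IsTab {
  tab_shape : forall k j, (T k j != [::]) = inshape lam k j;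
  tab_mmset : forall k j, T k j != [::] -> is_mmset (T k j);
  tab_row : forall k j, T k j != [::] -> T k j.+1 != [::] ->
    (mmax (T k j) <= mmin (T k j.+1))%N;
  tab_col : forall k j, T k j != [::] -> T k.+1 j != [::] ->
    (mmax (T k j) < mmin (T k.+1 j))%N;
  tab_bnd : forall k j, T k j != [::] -> (mmax (T k j) < L + (i <= k))%N }.

Definition push i c (a : nat * bool) T : tab :=
  fun k j => if (k == i) && (j == c) then rcons (T k j) a else T k j.

Lemma push_at i c a T : push i c a T i c = rcons (T i c) a.
Proof. by rewrite /push !eqxx. Qed.

Lemma push_out i c a T k j : (k, j) != (i, c) -> push i c a T k j = T k j.
Proof. by rewrite /push xpair_eqE => /negPf ->. Qed.

Lemma push_inj i c a a' T T' : push i c a T = push i c a' T' -> a = a' /\ T = T'.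
Proof.
move=> E; have := congr1 (fun f => f i c) E; rewrite /= !push_at => /rcons_inj[E1 E2].
split=> //; apply/funext => k; apply/funext => j.
case: (eqVneq (k, j) (i, c)) => [[-> ->] //|kj].
by have := congr1 (fun f => f k j) E; rewrite /= !push_out.
Qed.

Lemma tab_row_le lam L i T k j j' : is_tab lam L i T -> (j <= j')%N ->
  T k j != [::] -> T k j' != [::] -> (mmax (T k j) <= mmax (T k j'))%N.
Proof.
move=> tT /subnKC <-; elim: (j' - j)%N => [|d IHd] Tj; first by rewrite addn0.
rewrite addnS => Td; have Td' : T k (j + d)%N != [::].
  by move: Tj Td; rewrite !(tab_shape tT) /inshape; lia.
apply: leq_trans (IHd Tj Td') _.
by apply: leq_trans (tab_row tT Td' Td) _; apply: mmin_le_mmax; exact: tab_mmset tT _ _ Td.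
Qed.

(** * Peeling the last letter off a corner cell *)

Section Step.
Variables (lam : nat -> nat) (L i c : nat).
Hypotheses (lam_i : lam i = c.+1) (mu_i : (mu i <= c)%N) (lam_i1 : (lam i.+1 <= c)%N).

Let shape_right T L' i' : is_tab lam L' i' T -> T i c.+1 = [::].
Proof.
by move=> tT; apply/eqP/negPn; rewrite (tab_shape tT) /inshape lam_i; lia.
Qed.

Let shape_below T L' i' : is_tab lam L' i' T -> T i.+1 c = [::].
Proof.
by move=> tT; apply/eqP/negPn; rewrite (tab_shape tT) /inshape; move: lam_i1; lia.
Qed.

Let shape_at T L' i' : is_tab lam L' i' T -> T i c != [::].
Proof. by move=> tT; rewrite (tab_shape tT) /inshape lam_i mu_i ltnSn. Qed.

Lemma tab_weaken T : is_tab lam L i.+1 T -> is_tab lam L i T.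
Proof.
case=> h1 h2 h3 h4 h5; split=> // k j Tkj; apply: leq_trans (h5 k j Tkj) _.
by rewrite leq_add2l; case: ltngtP.
Qed.

(** Rows increase weakly and [c] is the last column of row [i], so a bound on that cell bounds the
    whole row. *)
Lemma tab_strengthen T : is_tab lam L i T -> (mmax (T i c) < L)%N -> is_tab lam L i.+1 T.
Proof.
move=> tT TL; split; try by case: tT.
move=> k j Tkj; case: (eqVneq k i) => [ki|ki]; last first.
  by have := tab_bnd tT Tkj; rewrite [(i <= k)%N]leq_eqVlt eq_sym (negPf ki).
subst k; rewrite ltnn addn0; apply: leq_ltn_trans TL.
apply: (tab_row_le tT) => //; last exact: shape_at tT.
by move: Tkj; rewrite (tab_shape tT) /inshape lam_i; lia.
Qed.

Lemma push_neq0 a T k j :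
  (push i c a T k j != [::]) = ((k, j) == (i, c)) || (T k j != [::]).
Proof.
rewrite /push xpair_eqE; case: andP => //= _.
by rewrite -size_eq0 size_rcons.
Qed.

Lemma mmin_push b T k j : T i c != [::] -> mmin (push i c (L, b) T k j) = mmin (T k j).
Proof.
move=> Tic; rewrite /push; case: andP => // -[/eqP -> /eqP ->].
by rewrite mmin_rcons (negPf Tic).
Qed.

(** A marked [L] must exceed the letter before it, which forces all of row [i] below [L] and so
    leads to stage [i + 1]; an unmarked [L] may repeat. *)
Lemma tab_push_append b T : T i c != [::] ->
  is_tab lam L i (push i c (L, b) T) <-> is_tab lam L (if b then i.+1 else i) T.
Proof.
move=> Tic; have nz k j : (push i c (L, b) T k j != [::]) = (T k j != [::]).
  by rewrite push_neq0; case: eqP => // -[-> ->]; rewrite Tic.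
split=> tT.
  have tw : is_tab lam L i T.
    split=> [k j|k j Tkj|k j Tkj Tkj1|k j Tkj Tk1j|k j Tkj].
    - by rewrite -nz (tab_shape tT).
    - have := Tkj; rewrite -nz => /(tab_mmset tT).
      case: (eqVneq (k, j) (i, c)) => [[-> ->]|kj]; last by rewrite push_out.
      by rewrite push_at is_mmset_rcons // => /and3P[].
    - case: (eqVneq (k, j) (i, c)) => [[ki jc]|kj].
        by move: Tkj1; rewrite -nz ki jc (shape_right tT).
      have := tab_row tT (k := k) (j := j); rewrite !nz => /(_ Tkj Tkj1).
      by rewrite mmin_push // push_out.
    - case: (eqVneq (k, j) (i, c)) => [[ki jc]|kj].
        by move: Tk1j; rewrite -nz ki jc (shape_below tT).
      have := tab_col tT (k := k) (j := j); rewrite !nz => /(_ Tkj Tk1j).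
      by rewrite mmin_push // push_out.
    - case: (eqVneq (k, j) (i, c)) => [[ki jc]|kj]; last first.
        by have := tab_bnd tT (k := k) (j := j); rewrite nz push_out // => /(_ Tkj).
      have := tab_mmset tT (k := i) (j := c); rewrite nz push_at is_mmset_rcons //.
      by move=> /(_ Tic) /and3P[_ h _]; rewrite ki jc leqnn addn1 ltnS.
  case: b nz tT => // nz tT; apply: tab_strengthen => //.
  have := tab_mmset tT (k := i) (j := c); rewrite nz push_at is_mmset_rcons //.
  by move=> /(_ Tic) /and3P[].
have tw : is_tab lam L i T by case: b tT {nz} => // /tab_weaken.
split=> [k j|k j|k j|k j|k j]; rewrite ?nz.
- exact: tab_shape tw _ _.
- case: (eqVneq (k, j) (i, c)) => [[-> ->] _|kj]; last first.
    by rewrite push_out //; exact: tab_mmset tw _ _.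
  rewrite push_at is_mmset_rcons // (tab_mmset tw Tic) /=.
  have := tab_bnd tT Tic; case: (b); rewrite ?ltnn ?leqnn ?addn0 ?addn1 ?ltnS; lia.
- rewrite mmin_push //; case: (eqVneq (k, j) (i, c)) => [[-> ->]|kj].
    by rewrite (shape_right tw).
  by rewrite push_out //; exact: tab_row tw _ _.
- rewrite mmin_push //; case: (eqVneq (k, j) (i, c)) => [[-> ->]|kj].
    by rewrite (shape_below tw).
  by rewrite push_out //; exact: tab_col tw _ _.
- case: (eqVneq (k, j) (i, c)) => [[-> ->]|kj].
    by rewrite push_at mmax_rcons leqnn addn1 ltnSn.
  by rewrite push_out //; exact: tab_bnd tw _ _.
Qed.

(** A letter alone in its cell is unmarked, and removing it shortens the row. Conversely the new
    cell is compatible with its neighbours by the bounds alone: at most [L] to the left, less than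
    [L] above. *)
Lemma tab_push_new b T : T i c = [::] ->
  is_tab lam L i (push i c (L, b) T) <-> ~~ b /\ is_tab (upd lam i c) L i T.
Proof.
move=> Tic; split=> [tT|[nb tT]].
  have nzP k j : T k j != [::] -> (k, j) != (i, c).
    by apply: contraNneq => -[-> ->]; rewrite Tic.
  have nz k j : T k j != [::] -> push i c (L, b) T k j != [::].
    by rewrite push_neq0 => ->; rewrite orbT.
  split.
    have := tab_mmset tT (k := i) (j := c).
    by rewrite push_neq0 eqxx push_at Tic is_mmset1; apply.
  split=> [k j|k j Tkj|k j Tkj Tkj1|k j Tkj Tk1j|k j Tkj].
  - have := tab_shape tT k j; rewrite push_neq0 /inshape /upd xpair_eqE.
    case: (eqVneq k i) => [->|_] //=; rewrite lam_i.
    by case: (eqVneq j c) => [->|jc] /=; rewrite ?Tic ?eqxx; lia.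
  - by have := tab_mmset tT (nz _ _ Tkj); rewrite push_out ?nzP.
  - by have := tab_row tT (nz _ _ Tkj) (nz _ _ Tkj1); rewrite !push_out ?nzP.
  - by have := tab_col tT (nz _ _ Tkj) (nz _ _ Tk1j); rewrite !push_out ?nzP.
  - by have := tab_bnd tT (nz _ _ Tkj); rewrite push_out ?nzP.
have right0 : T i c.+1 = [::].
  by apply/eqP/negPn; rewrite (tab_shape tT) /inshape /upd eqxx; lia.
have below0 : T i.+1 c = [::].
  apply/eqP/negPn; rewrite (tab_shape tT) /inshape /upd; move: lam_i1.
  by case: eqP => [|_]; lia.
have atE : push i c (L, b) T i c = [:: (L, b)] by rewrite push_at Tic.
split=> [k j|k j|k j|k j|k j]; rewrite ?push_neq0.
- rewrite (tab_shape tT) /inshape /upd xpair_eqE.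
  case: (eqVneq k i) => [->|_] //=; rewrite lam_i.
  by case: (eqVneq j c) => [->|jc] /=; move: mu_i; lia.
- case: (eqVneq (k, j) (i, c)) => [[-> ->] _|kj /= Tkj]; first by rewrite atE is_mmset1.
  by rewrite push_out //; exact: tab_mmset tT _ _ Tkj.
- case: (eqVneq (k, j) (i, c)) => [[-> ->] _|kj /= Tkj].
    by rewrite right0 xpair_eqE (gtn_eqF (ltnSn c)) andbF.
  rewrite (push_out _ _ kj).
  case: (eqVneq (k, j.+1) (i, c)) => [[ki jc] _|kj1 /= Tkj1]; last first.
    by rewrite push_out //; exact: (tab_row tT).
  rewrite ki jc atE /mmin /=.
  by have := tab_bnd tT Tkj; rewrite ki leqnn addn1 ltnS.
- case: (eqVneq (k, j) (i, c)) => [[-> ->] _|kj /= Tkj].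
    by rewrite below0 xpair_eqE (gtn_eqF (ltnSn i)).
  rewrite (push_out _ _ kj).
  case: (eqVneq (k.+1, j) (i, c)) => [[ki jc] _|kj1 /= Tkj1]; last first.
    by rewrite push_out //; exact: (tab_col tT).
  rewrite ki jc atE /mmin /=.
  by have := tab_bnd tT Tkj; rewrite -ki ltnn addn0 jc.
- case: (eqVneq (k, j) (i, c)) => [[-> ->] _|kj /= Tkj].
    by rewrite atE /mmax /= leqnn addn1.
  by rewrite push_out //; exact: (tab_bnd tT).
Qed.

(** The classes, by the last letter of the corner cell: less than [L]; a marked [L]; an unmarked [L]
    after other letters; a solitary [L]. *)
Lemma tab_decomp :
  [set T | is_tab lam L i T] =
  ([set T | is_tab lam L i.+1 T] `|` push i c (L, true) @` [set T | is_tab lam L i.+1 T])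
  `|` (push i c (L, false) @` [set T | is_tab lam L i T] `|`
       push i c (L, false) @` [set T | is_tab (upd lam i c) L i T]).
Proof.
apply/seteqP; split=> T /=.
  move=> tT; have Tic := shape_at tT.
  have [TL|TL] := ltnP (mmax (T i c)) L; first by left; left; exact: tab_strengthen.
  have [b [T' TE]] : exists b T', T = push i c (L, b) T'.
    have [s [[v b] Ts]] : exists s a, T i c = rcons s a.
      by case/lastP: (T i c) Tic => // s a _; exists s, a.
    exists b, (fun k j => if (k, j) == (i, c) then s else T k j).
    apply/funext => k; apply/funext => j; rewrite /push xpair_eqE.
    case: andP => // -[/eqP -> /eqP ->]; rewrite Ts; congr rcons; congr pair.
    move: TL; have := tab_bnd tT (shape_at tT); rewrite Ts mmax_rcons leqnn /=; lia.
  move: tT; rewrite TE; case: (eqVneq (T' i c) [::]) => T'ic.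
    by rewrite tab_push_new // => -[/negPf -> tT]; right; right; exists T'.
  rewrite tab_push_append //; case: b {TE} => tT; first by left; right; exists T'.
  by right; left; exists T'.
case=> [[/tab_weaken //|[T' tT <-]]|[[T' tT <-]|[T' tT <-]]].
- by rewrite tab_push_append //; exact: shape_at tT.
- by rewrite tab_push_append //; exact: shape_at tT.
- rewrite tab_push_new //; apply/eqP/negPn; rewrite (tab_shape tT).
  by rewrite /inshape /upd eqxx ltnn andbF.
Qed.

End Step.

(** Either row [i] is empty, or each of its cells has a cell below with entries at most [L], and
    columns are strict. *)
Lemma tab_boundary lam L i : (lam i = lam i.+1 \/ lam i = mu i) ->
  [set T | is_tab lam L i T] = [set T | is_tab lam L i.+1 T].
Proof.
move=> H; apply/seteqP; split=> T /=; last exact: tab_weaken.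
move=> tT; split; try by case: tT.
move=> k j Tkj; case: (eqVneq k i) => [ki|ki]; last first.
  by have := tab_bnd tT Tkj; rewrite [(i <= k)%N]leq_eqVlt eq_sym (negPf ki).
subst k; rewrite ltnn addn0; have Tij := Tkj.
move: Tij; rewrite (tab_shape tT) /inshape => sh.
have Ti1 : T i.+1 j != [::].
  by rewrite (tab_shape tT) /inshape; have := mu_decr (leqnSn i); case: H; move: sh; lia.
apply: (leq_trans (tab_col tT Tkj Ti1)); rewrite -ltnS.
apply: leq_ltn_trans (mmin_le_mmax (tab_mmset tT Ti1)) _.
by have := tab_bnd tT Ti1; rewrite leqnSn addn1.
Qed.

End Tab.

(** * Weights and the recursion for tableaux *)

Section Content.
Implicit Types (T : tab) (m : mon).

Definition cell_content (s : mmset) : mon := \big[mmul/mone]_(a <- s) ucm a.1.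

Definition content n M T : mon :=
  \big[mmul/mone]_(k < n) \big[mmul/mone]_(j < M) cell_content (T k j).

Lemma cm_big (I : Type) (r : seq I) (F : I -> mon) v :
  (\big[mmul/mone]_(i <- r) F i) v = (\sum_(i <- r) F i v)%N.
Proof.
elim: r => [|i r IHr]; first by rewrite !big_nil cm1.
by rewrite !big_cons cmM IHr.
Qed.

Lemma cell_content_at s a : a \in s -> (0 < cell_content s a.1)%N.
Proof.
move=> sa; by rewrite /cell_content cm_big (big_rem a) //= ucmE eqxx.
Qed.

Lemma mdeg_cell_content s : mdeg (cell_content s) = size s.
Proof.
rewrite /cell_content mdeg_prod; under eq_bigr do rewrite mdegU.
by rewrite sum1_size.
Qed.

Lemma cell_content_le n M T k j v : (k < n)%N -> (j < M)%N ->
  (cell_content (T k j) v <= content n M T v)%N.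
Proof.
move=> kn jM.
have -> : content n M T v = (\sum_(k < n) \sum_(j < M) cell_content (T k j) v)%N.
  by rewrite /content [LHS]cm_big; apply: eq_bigr => k' _; exact: cm_big.
by rewrite (bigD1 (Ordinal kn)) //= (bigD1 (Ordinal jM)) //= -addnA leq_addr.
Qed.

Lemma size_cell_le n M T k j : (k < n)%N -> (j < M)%N ->
  (size (T k j) <= mdeg (content n M T))%N.
Proof.
move=> kn jM.
have -> : mdeg (content n M T) = (\sum_(k < n) \sum_(j < M) size (T k j))%N.
  rewrite /content [LHS]mdeg_prod; apply: eq_bigr => k' _; rewrite [LHS]mdeg_prod.
  by apply: eq_bigr => j' _; exact: mdeg_cell_content.
by rewrite (bigD1 (Ordinal kn)) //= (bigD1 (Ordinal jM)) //= -addnA leq_addr.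
Qed.

Lemma finite_bounded_tabs n M d N :
  finite_set [set T : tab | [/\ forall k j, (n <= k)%N || (M <= j)%N -> T k j = [::],
    forall k j, (size (T k j) <= d)%N & forall k j a, a \in T k j -> (a.1 < N)%N]].
Proof.
pose ext (t : {ffun 'I_n * 'I_M -> d.-bseq ('I_N * bool)}) : tab := fun k j =>
  match insub k, insub j with
  | Some k', Some j' => [seq (val a.1, a.2) | a <- t (k', j')]
  | _, _ => [::]
  end.
apply: (@sub_finite_set _ _ (range ext)); last exact/finite_image/finite_finset.
move=> T /= [out sz bd]; pose dec (k j : nat) : seq ('I_N * bool) :=
  pmap (fun a : nat * bool => omap (fun v => (v, a.2)) (insub a.1)) (T k j).
have szd k j : (size (dec k j) <= d)%N.
  by apply: leq_trans (sz k j); rewrite size_pmap count_size.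
exists [ffun p : 'I_n * 'I_M => Bseq (szd p.1 p.2)] => //.
apply/funext => k; apply/funext => j; rewrite /ext.
case: insubP => [k' _ kk'|]; last by rewrite -leqNgt => nk; rewrite out ?nk.
case: insubP => [j' _ jj'|]; last by rewrite -leqNgt => Mj; rewrite out ?Mj ?orbT.
rewrite ffunE /= /dec kk' jj'; have := bd k j.
elim: (T k j) => //= -[v b] s IHs sN.
have vN : (v < N)%N by apply: (sN (v, b)); rewrite mem_head.
by rewrite insubT /= IHs // => a sa; apply: sN; rewrite inE sa orbT.
Qed.

End Content.

Section Weights.
Variables (R : comNzRingType) (alpha beta : nat -> R) (n M : nat).
Implicit Types T : tab.

Definition wcell (k j : nat) (s : mmset) : fps R :=
  (\prod_(a <- s) fpsX R a.1) *
  fpsC (alpha j ^+ (nunmarked s).-1 * (- beta k) ^+ nmarked s).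

(** Positions outside the shape hold the empty sequence, of weight 1 because [0.-1 = 0]; hence the
    product may run over a fixed box. *)
Definition twt T : fps R := \prod_(k < n) \prod_(j < M) wcell k j (T k j).

Definition fpsM (b : mon) : fps R := FPS (fun m => (m == b)%:R).

Lemma fpsMM b b' : fpsM (mmul b b') = fpsM b * fpsM b'.
Proof.
apply: fpsP => m; rewrite (@fcoef_monM _ b 1) => [|a /=]; last by case: eqP.
rewrite /= mul1r eq_sym.
case: ifPn => bm; last first.
  case: eqP => // E; case/negP: bm; apply/in_mdivs => i.
  by rewrite -E cmM leq_addr.
by rewrite divcmP bm eq_sym.
Qed.

Lemma fpsM1 : fpsM mone = 1.
Proof. by []. Qed.

Lemma wcell_mon k j s : wcell k j s = fpsM (cell_content s) *
  fpsC (alpha j ^+ (nunmarked s).-1 * (- beta k) ^+ nmarked s).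
Proof. by rewrite /wcell /cell_content (big_morph _ fpsMM fpsM1). Qed.

Lemma twt_content T m : fcoef (twt T) m != 0 -> m = content n M T.
Proof.
have [c ->] : exists c, twt T = fpsC c * fpsM (content n M T).
  exists (\prod_(k < n) \prod_(j < M)
    (alpha j ^+ (nunmarked (T k j)).-1 * (- beta k) ^+ nmarked (T k j))).
  rewrite /content (big_morph _ fpsMM fpsM1) fpsC_prod -big_split; apply: eq_bigr => k _.
  rewrite /= (big_morph _ fpsMM fpsM1) fpsC_prod -big_split; apply: eq_bigr => j _.
  by rewrite wcell_mon mulrC.
by rewrite fcoef_CM /=; case: (m =P _) => // _; rewrite mulr0 eqxx.
Qed.

Lemma twt_bound T m k j a : fcoef (twt T) m != 0 -> (k < n)%N -> (j < M)%N ->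
  a \in T k j -> a.1 \in finsupp m.
Proof.
move=> /twt_content -> kn jM /cell_content_at; rewrite -cmE_neq0 -lt0n => h.
exact: leq_trans h (cell_content_le _ _ _ _).
Qed.

(** A weight is a scalar times the monomial [content]. A given monomial bounds the cell sizes by its
    degree and the entries by its support. *)
Lemma twt_summable (D : set tab) :
    (forall T, D T -> forall k j, (n <= k)%N || (M <= j)%N -> T k j = [::]) ->
  fps_summable D twt.
Proof.
move=> out m; pose N := (\max_(i <- finsupp m) i.+1)%N.
apply: sub_finite_set (finite_bounded_tabs n M (mdeg m) N) => T [DT Tm] /=.
have inside k j : T k j != [::] -> (k < n)%N /\ (j < M)%N.
  by move=> h; apply/andP; move: h; apply: contraNT; rewrite negb_and -!leqNgt => /(out _ DT) ->.
split=> [|k j|k j a Ta]; first exact: out DT.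
  have [->//|/inside[kn jM]] := eqVneq (T k j) [::].
  by rewrite (twt_content Tm) size_cell_le.
have [kn jM] : (k < n)%N /\ (j < M)%N by apply: inside; apply: contraTneq Ta => ->.
apply: (@leq_bigmax_seq _ _ xpredT (fun i => i.+1)) => //.
exact: twt_bound Tm kn jM Ta.
Qed.

(** The exponent of alpha is one less than the number of unmarked letters, so the first letter of a
    cell carries no parameter. *)
Lemma wcell_rcons k j s v b : (s = [::] -> ~~ b) -> (s != [::] -> is_mmset s) ->
  wcell k j (rcons s (v, b)) =
  fpsC (if s == [::] then 1 else if b then - beta k else alpha j) * fpsX R v *
  wcell k j s.
Proof.
move=> sb ss; rewrite /wcell /nunmarked /nmarked -cats1 big_cat big_seq1 !count_cat /=.
case: eqVneq => [s0|s0].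
  move: (sb s0); rewrite s0 big_nil /= => /negPf -> /=.
  by rewrite !expr0 (mulr1 (1 : R)) fpsC1; ring.
have := nunmarked_gt0 (ss s0); rewrite /nunmarked.
set u := count _ s; set w := count _ s; case: u => // u _.
case: b {sb}; rewrite /= !addn0 ?addn1 /= exprS !fpsCM; ring.
Qed.

Lemma twt_push i c v b T : (i < n)%N -> (c < M)%N ->
    (T i c = [::] -> ~~ b) -> (T i c != [::] -> is_mmset (T i c)) ->
  twt (push i c (v, b) T) =
  fpsC (if T i c == [::] then 1 else if b then - beta i else alpha c) * fpsX R v *
  twt T.
Proof.
move=> ilt cM T0 T1; pose io := Ordinal ilt; pose co := Ordinal cM.
rewrite /twt (bigD1 io) //= (bigD1 co) //= push_at wcell_rcons //.
rewrite [in RHS](bigD1 io) //= [in RHS](bigD1 co) //= -!mulrA.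
do 4!congr (_ * _); congr (_ * _).
  apply: eq_bigr => j jc; rewrite push_out // xpair_eqE eqxx /=.
  by rewrite -val_eqE in jc.
apply: eq_bigr => k ki; apply: eq_bigr => j _; rewrite push_out // xpair_eqE.
by rewrite -val_eqE /= in ki; rewrite (negPf ki).
Qed.

End Weights.

Section Recursion.
Variables (R : comNzRingType) (alpha beta : nat -> R) (n M : nat) (mu : nat -> nat).
Hypothesis mu_decr : forall i j, (i <= j)%N -> (mu j <= mu i)%N.

(** The shapes met by the recursion; they stay in the box over which [twt] multiplies. *)
Record admissible lam : Prop := Admissible {
  admissible_decr : forall i j, (i <= j)%N -> (lam j <= lam i)%N;
  admissible_sub : forall i, (mu i <= lam i)%N;
  admissible_n : forall i, (n <= i)%N -> lam i = 0%N;
  admissible_M : (lam 0%N <= M)%N }.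

Local Notation S L i lam := (fps_sum [set T | is_tab mu lam L i T] (twt alpha beta n M)).

Lemma tab_out lam L i T : admissible lam -> is_tab mu lam L i T ->
  forall k j, (n <= k)%N || (M <= j)%N -> T k j = [::].
Proof.
move=> gl tT k j H; apply/eqP/negPn; rewrite (tab_shape tT) /inshape.
case/orP: H => [/(admissible_n gl) -> //|Mj]; first by rewrite ltn0 andbF.
have := admissible_decr gl (leq0n k); have := admissible_M gl; lia.
Qed.

Lemma tab_summable lam L i : admissible lam ->
  fps_summable [set T | is_tab mu lam L i T] (twt alpha beta n M).
Proof. by move=> gl; apply: twt_summable => T /=; exact: tab_out. Qed.

Lemma admissible_upd lam i c : admissible lam -> lam i = c.+1 -> (mu i <= c)%N -> (lam i.+1 <= c)%N ->
  admissible (upd lam i c).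
Proof.
move=> gl lc mc l1; split.
- move=> k l kl; rewrite /upd; case: (l =P i) => li; case: (k =P i) => ki //.
  + by have := admissible_decr gl kl; rewrite li lc; lia.
  + by apply: leq_trans l1; apply: (admissible_decr gl); lia.
  + exact: admissible_decr.
- by move=> k; rewrite /upd; case: eqP => [->//|_]; exact: admissible_sub.
- move=> k nk; rewrite /upd; case: eqP => [ki|_]; last exact: admissible_n.
  by move: (admissible_n gl nk); rewrite ki lc.
- rewrite /upd; case: eqP => [i0|_]; last exact: admissible_M.
  by apply: leq_trans (admissible_M gl); rewrite i0 lc.
Qed.

Lemma solve_peeling (A : comNzRingType) (a b x s s1 s2 : A) :
    s = s1 + - b * x * s1 + (a * x * s + x * s2) ->
  (1 - a * x) * s = (1 - b * x) * s1 + x * s2.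
Proof. by move=> E; rewrite mulrBl mul1r {1}E; ring. Qed.

Lemma tab_sum_step lam L i c : admissible lam -> (i < n)%N ->
    lam i = c.+1 -> (mu i <= c)%N -> (lam i.+1 <= c)%N ->
  (1 - fpsC (alpha c) * fpsX R L) * S L i lam =
  (1 - fpsC (beta i) * fpsX R L) * S L i.+1 lam + fpsX R L * S L i (upd lam i c).
Proof.
move=> gl ilt lc mc l1.
have cM : (c < M)%N.
  by rewrite -lc; apply: leq_trans (admissible_decr gl (leq0n i)) (admissible_M gl).
have gu := admissible_upd gl lc mc l1.
have inj D b : set_inj D (push i c (L, b)) by move=> T T' _ _ /push_inj[].
have E1 L' i' lam' : (c < lam' i)%N -> (mu i <= c)%N -> forall T, is_tab mu lam' L' i' T ->
    T i c != [::] /\ is_mmset (T i c).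
  move=> cl mc' T tT; have h : T i c != [::] by rewrite (tab_shape tT) /inshape cl mc'.
  by split=> //; exact: (tab_mmset tT).
have cl : (c < lam i)%N by rewrite lc.
have E0 T : is_tab mu (upd lam i c) L i T -> T i c = [::].
  by move=> tT; apply/eqP/negPn; rewrite (tab_shape tT) /inshape /upd eqxx ltnn andbF.
have st : fps_sum (push i c (L, true) @` [set T | is_tab mu lam L i.+1 T])
    (twt alpha beta n M) = fpsC (- beta i) * fpsX R L * S L i.+1 lam.
  rewrite fps_sum_image // -fps_sumMl; last exact: tab_summable.
  apply: fps_sum_eq => T /(E1 _ _ _ cl mc)[T0 T1] /=.
  by rewrite twt_push ?(negPf T0) // => E; rewrite E in T0.
have sf : fps_sum (push i c (L, false) @` [set T | is_tab mu lam L i T])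
    (twt alpha beta n M) = fpsC (alpha c) * fpsX R L * S L i lam.
  rewrite fps_sum_image // -fps_sumMl; last exact: tab_summable.
  by apply: fps_sum_eq => T /(E1 _ _ _ cl mc)[T0 T1] /=; rewrite twt_push // (negPf T0).
have sn : fps_sum (push i c (L, false) @` [set T | is_tab mu (upd lam i c) L i T])
    (twt alpha beta n M) = fpsX R L * S L i (upd lam i c).
  rewrite fps_sum_image // -[fpsX R L]mul1r -fpsC1 -fps_sumMl; last exact: tab_summable.
  by apply: fps_sum_eq => T /E0 T0 /=; rewrite twt_push // T0.
have E : S L i lam = S L i.+1 lam + fpsC (- beta i) * fpsX R L * S L i.+1 lam +
    (fpsC (alpha c) * fpsX R L * S L i lam + fpsX R L * S L i (upd lam i c)).
  have dec := tab_decomp L lc mc l1.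
  have sm := tab_summable L i gl; rewrite dec in sm.
  (* The unpushed class has corner entries below [L], every pushed tableau has [L] there; pushed
     classes differ in the mark. *)
  have top T : is_tab mu lam L i.+1 T -> (mmax (T i c) < L)%N.
    move=> tT; have [T0 T1] := E1 _ _ _ cl mc _ tT.
    by have := tab_bnd tT T0; rewrite ltnn addn0.
  rewrite -st -sf -sn {1}dec fps_sumU //; last first.
    by move=> T [/top + |[T1 _ <-]] [[T2 _ E]|[T2 _ E]];
      rewrite -?E ?push_at ?mmax_rcons ?ltnn //; case: (push_inj E).
  congr (_ + _); rewrite fps_sumU //.
  - by apply: fps_summable_sub sm => T; left.
  - by move=> T /top + [T' tT' E]; rewrite -E push_at mmax_rcons ltnn.
  - by apply: fps_summable_sub sm => T; right.
  (* With equal marks, the tableaux before the push differ at the corner: nonempty in one class,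
     empty in the other. *)
  - move=> T [T1 tT1 <-] [T2 tT2] /push_inj[_ E]; subst T2.
    by have [+ _] := E1 _ _ _ cl mc _ tT1; rewrite (E0 _ tT2).
by rewrite fpsCN in E; exact: solve_peeling E.
Qed.

Lemma tab_sum_base lam : admissible lam -> S 0 n lam = ([forall k : 'I_n, lam k == mu k])%:R.
Proof.
move=> gl.
have nk0 T k j : is_tab mu lam 0 n T -> T k j = [::].
  move=> tT; have [nk|kn] := leqP n k; first by rewrite (tab_out gl tT) ?nk.
  apply/eqP/negPn/negP => h; have := tab_bnd tT h.
  by rewrite (leqNgt n) kn addn0 ltn0.
pose T0 : tab := fun _ _ => [::].
have tw0 : twt alpha beta n M T0 = 1.
  rewrite /twt big1 // => k _; rewrite big1 // => j _.
  by rewrite /wcell big_nil /= (mulr1 (1 : R)) fpsC1; ring.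
case: forallP => [H|/forallP/forallPn[i il]].
  have E k : lam k = mu k.
    have [nk|kn] := leqP n k; last exact: (eqP (H (Ordinal kn))).
    by have := admissible_sub gl k; rewrite (admissible_n gl nk); lia.
  have -> : [set T | is_tab mu lam 0 n T] = [set T0].
    apply/seteqP; split=> T /=; first by move=> tT; apply/funext => k; apply/funext => j; exact: nk0.
    by move=> ->; split=> // k j; rewrite /T0 /inshape E eqxx; lia.
  by apply: fpsP => m; rewrite /fps_sum /= fsbig_set1 tw0.
have -> : [set T | is_tab mu lam 0 n T] = set0.
  apply/seteqP; split=> T //= tT.
  have := tab_shape tT i (mu i); rewrite (nk0 T) // /inshape eqxx leqnn.
  by have := admissible_sub gl i; move: il; lia.
by apply: fpsP => m; rewrite /fps_sum /= fsbig_set0.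
Qed.

Lemma tab_sum_recL lam L : admissible lam -> S L.+1 n lam = S L 0%N lam.
Proof.
move=> gl; congr fps_sum; apply/seteqP; split=> T /= tT; split; try by case: tT.
  move=> k j h; have := tab_bnd tT h; rewrite addn1.
  have [nk|kn] := leqP n k; first by move: h; rewrite (tab_out gl tT) ?nk.
  by rewrite addn0.
move=> k j h; have := tab_bnd tT h; rewrite addn1 => /leq_trans; apply.
exact: leq_addr.
Qed.

Lemma tab_sum_gdet lam L i : admissible lam -> (i <= n)%N ->
  S L i lam = gdet n alpha beta mu L i lam.
Proof.
have down L' : (forall lam, admissible lam -> S L' n lam = gdet n alpha beta mu L' n lam) ->
    forall d lam, admissible lam -> S L' (n - d) lam = gdet n alpha beta mu L' (n - d) lam.
  move=> HL; elim=> [|d IHd] lam' gl; first by rewrite subn0; exact: HL.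
  have [nd|dn] := leqP n d.
    have E : (n - d.+1 = n - d)%N by lia.
    by rewrite E; exact: IHd.
  set k := (n - d.+1)%N; have kn : (k < n)%N by rewrite /k; lia.
  have kd : (n - d = k.+1)%N by rewrite /k; lia.
  rewrite {}kd in IHd; clearbody k.
  have [c lk] : exists c, lam' k = c by exists (lam' k).
  elim: c lam' gl lk => [|c IHc] lam' gl lk.
    have lm : lam' k = mu k by have := admissible_sub gl k; rewrite lk; lia.
    rewrite (tab_boundary mu_decr L' (or_intror lm)) (IHd _ gl).
    by rewrite (gdet_boundary alpha beta mu_decr L' kn (admissible_decr gl) (or_intror lm)).
  have [lm|lm] := eqVneq (lam' k) (mu k).
    rewrite (tab_boundary mu_decr L' (or_intror lm)) (IHd _ gl).
    by rewrite (gdet_boundary alpha beta mu_decr L' kn (admissible_decr gl) (or_intror lm)).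
  have [ll|ll] := eqVneq (lam' k) (lam' k.+1).
    (* Row [k + 1] has the positive length [c + 1], so it is one of the first [n] rows. *)
    have k1n : (k.+1 < n)%N.
      by rewrite ltnNge; apply/negP => /(admissible_n gl) l0; move: ll; rewrite l0 lk.
    rewrite (tab_boundary mu_decr L' (or_introl ll)) (IHd _ gl).
    by rewrite (gdet_boundary alpha beta mu_decr L' kn (admissible_decr gl) (or_introl (conj ll k1n))).
  have mc : (mu k <= c)%N by have := admissible_sub gl k; move: lm; rewrite lk; lia.
  have lc : (lam' k.+1 <= c)%N.
    by have := admissible_decr gl (leqnSn k); move: ll; rewrite lk; lia.
  (* Both sides satisfy the same equation, so their difference is killed by [1 - alpha_c x_L]. *)
  apply/eqP; rewrite -subr_eq0; apply/eqP.
  apply: (@mul_oneBX_inj _ (alpha c) L').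
  rewrite mulrBr (tab_sum_step L' gl kn lk mc lc) gdet_step // IHd // IHc ?subrr //.
    exact: admissible_upd.
  by rewrite /upd eqxx.
elim: L i lam => [|L IHL] i lam gl ni; rewrite -(subKn ni); apply: down => //.
  move=> lam' gl'; rewrite tab_sum_base // gdet_base //; [exact: admissible_decr|exact: admissible_sub].
by move=> lam' gl'; rewrite tab_sum_recL // gdet_recL IHL.
Qed.

End Recursion.

(** * Expansion of the determinant *)

Section Homogeneous.
Variable R : comNzRingType.
Implicit Types (f g : fps R) (k : int).

Definition homog k f := forall m, fcoef f m != 0 -> (mdeg m)%:Z = k.

Lemma homogM k l f g : homog k f -> homog l g -> homog (k + l) (f * g).
Proof.
move=> hf hg m; rewrite fcoefM => fg0.
have [a am /andP[fa ga]] : exists2 a, a \in mdivs m &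
    (fcoef f a != 0) && (fcoef g (divcm m a) != 0).
  apply: contrapT => H; case/eqP: fg0; rewrite big1_seq // => a /andP[_ am].
  apply: contrapT => /eqP fga; apply: H; exists a => //; apply/andP; split.
    by apply: contraNneq fga => ->; rewrite mul0r.
  by apply: contraNneq fga => ->; rewrite mulr0.
have /eqP <- : mmul a (divcm m a) == m by rewrite divcmP am eqxx.
by rewrite mdegM PoszD (hf _ fa) (hg _ ga).
Qed.

Lemma homogN k f : homog k f -> homog k (- f).
Proof. by move=> hf m fm; apply: hf; apply: contraNneq fm => f0; rewrite fcoefN f0 oppr0. Qed.

Lemma homog1 : homog 0 (1 : fps R).
Proof.
move=> m; rewrite -fpsC1 /=; case: (m =P mone) => [->|_]; first by rewrite mdeg1.
by rewrite eqxx.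
Qed.

Lemma homog_prod (I : Type) (r : seq I) (F : I -> fps R) (k : I -> int) :
  (forall i, homog (k i) (F i)) -> homog (\sum_(i <- r) k i) (\prod_(i <- r) F i).
Proof.
by move=> H; elim/big_rec2: _ => [|i a f _ hf]; [exact: homog1|exact: homogM].
Qed.

Lemma homog_sum (I : Type) (r : seq I) (F : I -> fps R) k :
  (forall i, homog k (F i)) -> homog k (\sum_(i <- r) F i).
Proof.
move=> H m; rewrite fcoef_sum; elim: r => [|i r IHr]; first by rewrite big_nil eqxx.
rewrite big_cons; have [->|/H //] := eqVneq (fcoef (F i) m) 0.
by rewrite add0r.
Qed.

Lemma hsym_homog k : homog k (hsym R k).
Proof. by move=> m /=; case: (_ =P k) => // _; rewrite eqxx. Qed.

(** The shifts [- i + s i] cancel over a permutation [s], so all Leibniz terms have the same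
    degree. *)
Lemma skew_schur_homog n (nu rho : gpar n) :
  homog (\sum_i nu i - \sum_i rho i) (skew_schur R nu rho).
Proof.
apply: homog_sum => s; rewrite -[X in homog X _]add0r; apply: homogM.
  by case: (s : bool); rewrite ?expr1 ?expr0; [apply: homogN|]; exact: homog1.
rewrite (_ : _ - _ = \sum_i (nu i - rho (s i) - i%:Z + (s i)%:Z)).
  by apply: homog_prod => i; rewrite mxE; exact: hsym_homog.
rewrite !big_split /= !sumrN [\sum_i rho i](reindex_perm s) /=.
rewrite [X in _ - _ - X](reindex_perm s) /=; ring.
Qed.

End Homogeneous.

Section Expansion.
Variables (R : comNzRingType) (n : nat) (alpha beta : nat -> R).
Variables (lam mu : {ffun 'I_n -> nat}).
Hypotheses (lam_part : is_part lam) (mu_part : is_part mu).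
Hypothesis mu_lam : forall i, (mu i <= lam i)%N.
Local Notation hp := (hpleth alpha beta).

(** Negative degrees fill a large block of zeros. Together with [coefC'_eq0] this accounts for the
    containments in the index set. *)
Lemma coefC_eq0 (nu : gpar n) i : is_gpar nu -> nu i < (lam i)%:Z ->
  Defs.coefC alpha beta lam nu = 0.
Proof.
move=> gnu ni; apply: (@det_zero_block _ _ _ i) => k j ik ji; rewrite mxE.
by apply: hpleth_lt0; have := gnu _ _ ik; have := lam_part ji; lia.
Qed.

Lemma coefC'_eq0 (rho : gpar n) i : is_gpar rho -> (mu i)%:Z < rho i ->
  coefC' alpha beta rho mu = 0.
Proof.
move=> grho ri; apply: (@det_zero_block _ _ _ i) => k j ik ji; rewrite mxE.
by apply: hpleth_lt0; have := grho _ _ ji; have := mu_part ik; lia.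
Qed.

Variables (d mu0 : nat).
Hypothesis mu0P : forall i, (mu i <= mu0)%N.

(* For monomials of degree at most d, the infinite matrix product can be
   restricted to the indices a - shift with a < width. *)
Definition shift : nat := n + d.
Definition width : nat := (shift + mu0 + d).+1.

(** Selecting columns here, or rows of [rightmx], gives the transposes of the matrices in [coefC]
    and [coefC']. *)
Definition leftmx : 'M[fps R]_(n, width) := \matrix_(i, a)
  fpsC (hp (a%:Z - shift%:Z - (lam i)%:Z + i%:Z) (Asum (lam i) - Bsum i)).
Definition midmx : 'M[fps R]_width := \matrix_(a, b) hsym R (a%:Z - b%:Z).
Definition rightmx : 'M[fps R]_(width, n) := \matrix_(b, j)
  fpsC (hp ((mu j)%:Z - j%:Z - b%:Z + shift%:Z) (- Asum (mu j) + Bsum j.+1)).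

(** The convolution of [hplethD], reindexed by [a = i + p + shift]. The bounds keep its range inside
    the window, and any other [a] gives one factor a negative degree. *)
Lemma hplethD_window (p q : int) (e : nat) Z Z' : (e <= d)%N -> 0 <= p + shift%:Z - d%:Z ->
    q <= mu0%:Z ->
  hp (e%:Z + q - p) (Z + Z') =
  \sum_(a < width) hp (a%:Z - shift%:Z - p) Z * hp (q - a%:Z + shift%:Z + e%:Z) Z'.
Proof.
move=> ed p0 q0; rewrite -(big_mkord xpredT (fun a =>
  hp (a%:Z - shift%:Z - p) Z * hp (q - a%:Z + shift%:Z + e%:Z) Z')).
have [N0|N0] := ltP (e%:Z + q - p) 0.
  rewrite hpleth_lt0 // big1 // => a _.
  have [ap|ap] := ltP (a%:Z - shift%:Z - p) 0; first by rewrite hpleth_lt0 ?mul0r.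
  by rewrite [X in _ * X]hpleth_lt0 ?mulr0 //; move: N0 ap; lia.
have [N NE] : exists N : nat, e%:Z + q - p = N by exists `|(e%:Z + q - p)%R|%N; lia.
have [s sE] : exists s : nat, p + shift%:Z = s by exists `|(p + shift%:Z)%R|%N; lia.
have sw : (s + N.+1 <= width)%N by move: sE NE; rewrite /width; lia.
rewrite (@big_cat_nat _ _ _ s) ?(leq_trans _ sw) ?leq_addr //=.
rewrite big_nat_cond big1 ?add0r; last first.
  by move=> a /andP[/andP[_ h] _]; rewrite hpleth_lt0 ?mul0r //; lia.
rewrite (@big_cat_nat _ _ _ (s + N.+1)) ?leq_addr //=.
rewrite [X in _ = _ + X]big_nat_cond [X in _ = _ + X]big1 ?addr0; last first.
  by move=> a /andP[/andP[h _] _]; rewrite [X in _ * X]hpleth_lt0 ?mulr0 //; lia.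
rewrite NE hplethD -{1}[s]add0n big_addn addKn big_mkord.
apply: eq_bigr => i _; congr (hp _ _ * hp _ _); first lia.
by have := ltn_ord i; lia.
Qed.

Lemma fcoef_window (i j : 'I_n) (m : mon) : (mdeg m <= d)%N ->
  fcoef ((leftmx *m (midmx *m rightmx)) i j) m =
  hp ((mdeg m)%:Z + (mu j)%:Z - j%:Z - (lam i)%:Z + i%:Z)
     (Asum (lam i) - Bsum i + (- Asum (mu j) + Bsum j.+1)).
Proof.
move=> md; set e := mdeg m in md *.
rewrite (_ : _ - _ - _ + _ = e%:Z + ((mu j)%:Z - j%:Z) - ((lam i)%:Z - i%:Z)); last lia.
rewrite hplethD_window //; [|by rewrite /shift; have := ltn_ord i; lia
  |by have := mu0P j; lia].
rewrite mxE fcoef_sum; apply: eq_bigr => a _; rewrite !mxE fcoef_CM.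
(* The middle factor forces [b = a - e]. If this leaves the window, the left factor already has
   negative degree, as [shift = n + d] exceeds [i + e]. *)
have [ae|ea] := ltnP a e.
  rewrite [in RHS]hpleth_lt0 ?mul0r; last by move: ae; rewrite /shift; have := ltn_ord i; lia.
  by rewrite [X in X * _]hpleth_lt0 ?mul0r //; move: ae; rewrite /shift; have := ltn_ord i; lia.
congr (hp _ _ * _); first lia.
have bw : (a - e < width)%N by apply: leq_ltn_trans (ltn_ord a); rewrite leq_subr.
have T (b : 'I_width) : fcoef (midmx a b * rightmx b j) m =
    hp ((mu j)%:Z - j%:Z - b%:Z + shift%:Z) (- Asum (mu j) + Bsum j.+1) *
    (e%:Z == a%:Z - b%:Z)%:R.
  by rewrite !mxE mulrC fcoef_CM.
rewrite fcoef_sum (eq_bigr _ (fun b _ => T b)) (bigD1 (Ordinal bw)) //=.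
rewrite (_ : (_ == _) = true); last by lia.
rewrite mulr1 big1 ?addr0 => [|b ba]; first by congr (hp _ _); lia.
rewrite (_ : (_ == _) = false) ?mulr0 //.
by apply/negP => /eqP E; case/eqP: ba; apply/val_inj => /=; lia.
Qed.

Definition gpar_of (f : {ffun 'I_n -> 'I_width}) : gpar n :=
  [ffun i => (f i)%:Z - shift%:Z + i%:Z].

Lemma gpar_of_inj : injective gpar_of.
Proof.
move=> f g /ffunP fg; apply/ffunP => i; apply/val_inj => /=.
by have := fg i; rewrite !ffunE; lia.
Qed.

Lemma is_gpar_of f : decr f -> is_gpar (gpar_of f).
Proof.
move=> /decrP fd i j; rewrite leq_eqVlt => /orP[/eqP/val_inj -> //|ij].
rewrite !ffunE /=; suff H k : forall j : 'I_n, (j = i + k :> nat)%N -> (f j + k <= f i)%N.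
  by have := H (j - i)%N j (esym (subnKC (ltnW ij))); lia.
elim: k => [|k IHk] {ij}j ji; first by rewrite addn0 (_ : j = i) //; apply/val_inj; rewrite /= ji addn0.
have kn : (i + k < n)%N by have := ltn_ord j; lia.
have := IHk (Ordinal kn) erefl; have : (Ordinal kn < j)%N by rewrite /=; lia.
by move/fd => /=; lia.
Qed.

Lemma fpsC_det k (A : 'M[R]_k) : \det (\matrix_(i, j) fpsC (A i j)) = fpsC (\det A).
Proof.
have addC : {morph (@fpsC R) : x y / x + y}.
  by move=> x y; apply: fpsP => m; rewrite fcoefD /=; case: ifP; rewrite ?addr0.
have C0 : fpsC 0 = 0 :> fps R by apply: fpsP => m /=; rewrite if_same.
rewrite /determinant (big_morph _ addC C0); apply: eq_bigr => s _.
rewrite fpsCM fpsC_prod; congr (_ * _).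
  by case: (s : bool); rewrite ?expr1 ?expr0 ?fpsCN fpsC1.
by apply: eq_bigr => i _; rewrite mxE.
Qed.

Lemma det_window : \det (leftmx *m (midmx *m rightmx)) =
  \sum_(f : {ffun 'I_n -> 'I_width} | decr f) \sum_(g : {ffun 'I_n -> 'I_width} | decr g)
    expansion_term alpha beta lam mu (gpar_of g, gpar_of f).
Proof.
rewrite Cauchy_Binet; apply: eq_bigr => f fd.
rewrite -mul_rowsub_mx Cauchy_Binet mulr_sumr; apply: eq_bigr => g gd.
rewrite /expansion_term /= mulrA; congr (_ * _ * _).
- rewrite /Defs.coefC -fpsC_det -det_tr; congr (\det _); apply/matrixP => i j.
  by rewrite !mxE ffunE; congr (fpsC (hp _ _)); lia.
- congr (\det _); apply/matrixP => i j; rewrite !mxE !ffunE; congr hsym; lia.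
- rewrite /coefC' -fpsC_det -det_tr; congr (\det _); apply/matrixP => i j.
  by rewrite !mxE ffunE; congr (fpsC (hp _ _)); lia.
Qed.

Local Notation term := (expansion_term alpha beta lam mu).

Lemma fcoef_term rho nu m : fcoef (term (rho, nu)) m =
  Defs.coefC alpha beta lam nu * fcoef (skew_schur R nu rho) m * coefC' alpha beta rho mu.
Proof. by rewrite /expansion_term mulrC fcoef_CM fcoef_CM mulrC. Qed.

(** By homogeneity the degree of [m] is the sum of the differences [nu i - rho i], which are
    nonnegative by the containments; so each is at most [d]. *)
Lemma term_window p m : (mdeg m <= d)%N -> expansion_index lam mu p ->
    fcoef (term p) m != 0 ->
  exists f g : {ffun 'I_n -> 'I_width}, [/\ decr f, decr g & p = (gpar_of g, gpar_of f)].
Proof.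
case: p => rho nu md [gg rmu ml lnu].
have {gg} [grho gnu] : is_gpar rho /\ is_gpar nu := gg.
rewrite fcoef_term => t0.
have hm : (mdeg m)%:Z = \sum_i (nu i - rho i).
  rewrite sumrB; apply: (@skew_schur_homog R n nu rho).
  by apply: contraNneq t0 => ->; rewrite mulr0 mul0r.
have r_mu i : rho i <= (mu i)%:Z by have := rmu i; rewrite ffunE.
have l_nu i : (lam i)%:Z <= nu i by have := lnu i; rewrite ffunE.
have diff i : nu i - rho i <= d%:Z.
  apply: (@le_trans _ _ (mdeg m)%:Z); last by lia.
  rewrite hm (bigD1 i) //= lerDl; apply: sumr_ge0 => j _.
  by have := r_mu j; have := l_nu j; have := mu_lam j; lia.
(* These bounds place [v i - i + shift] between 0 and [width - 1], which is the origin of both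
   constants. *)
have win (v : gpar n) : is_gpar v -> (forall i, (- d%:Z <= v i) /\ (v i <= mu0%:Z + d%:Z)) ->
    exists f : {ffun 'I_n -> 'I_width}, decr f /\ v = gpar_of f.
  move=> gv vb; have vE i : exists a : nat, v i - i%:Z + shift%:Z = a%:Z.
    exists `|(v i - i%:Z + shift%:Z)%R|%N; have [+ _] := vb i.
    by rewrite /shift; have := ltn_ord i; lia.
  pose f := [ffun i : 'I_n => inord `|(v i - i%:Z + shift%:Z)%R|%N : 'I_width].
  have fE i : (f i)%:Z = v i - i%:Z + shift%:Z.
    rewrite ffunE; have [a aE] := vE i; rewrite aE /= inordK //.
    by have [_ +] := vb i; move: aE; rewrite /shift; lia.
  exists f; split; last by apply/ffunP => i; rewrite [RHS]ffunE fE addrK subrK.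
  by apply/decrP => i j ij; have := gv _ _ (ltnW ij); rewrite -ltz_nat !fE; lia.
have [f [fd ->]] : exists f : {ffun 'I_n -> 'I_width}, decr f /\ nu = gpar_of f.
  apply: win => // i; have := r_mu i; have := l_nu i; have := diff i; have := mu0P i.
  by split; lia.
have [g [gd ->]] : exists g : {ffun 'I_n -> 'I_width}, decr g /\ rho = gpar_of g.
  apply: win => // i; have := r_mu i; have := l_nu i; have := diff i; have := mu0P i.
  by split; lia.
by exists f, g.
Qed.

Let pr (q : {ffun 'I_n -> 'I_width} * {ffun 'I_n -> 'I_width}) : gpar n * gpar n :=
  (gpar_of q.2, gpar_of q.1).

Lemma term_finite m : (mdeg m <= d)%N ->
  finite_set [set p | expansion_index lam mu p /\ fcoef (term p) m != 0].
Proof.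
move=> md; apply: (@sub_finite_set _ _ (range pr)); last exact/finite_image/finite_finset.
by move=> p [pi /(term_window md pi)[f [g [_ _ ->]]]]; exists (f, g).
Qed.

(** The two sums have the same nonzero terms: those of the expansion lie in the window, and those of
    the window satisfy the containments. *)
Lemma fcoef_expansion m : (mdeg m <= d)%N ->
  fcoef (fps_sum (expansion_index lam mu) term) m =
  fcoef (\det (leftmx *m (midmx *m rightmx))) m.
Proof.
move=> md; rewrite det_window pair_big fcoef_sum.
transitivity (\sum_(p \in expansion_index lam mu) fcoef (term p) m); first by [].
pose D : pred ({ffun 'I_n -> 'I_width} * {ffun 'I_n -> 'I_width}) :=
  fun q => decr q.1 && decr q.2.
transitivity (\sum_(p \in pr @` [set q | D q]) fcoef (term p) m); last first.
  rewrite fsbig_image; last by move=> [f g] [f' g'] _ _ [/gpar_of_inj -> /gpar_of_inj ->].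
  transitivity (\sum_(q \in [set` enum D]) fcoef (term (pr q)) m).
    by apply: eq_fsbigl; apply/seteqP; split=> q /=; rewrite mem_enum.
  by rewrite -fsbig_seq ?enum_uniq // big_enum.
rewrite fsbig_supp [RHS]fsbig_supp; apply: eq_fsbigl; apply/seteqP; split=> p [].
  move=> pI /eqP p0; split; last exact/eqP.
  have [f [g [fd gd ->]]] := term_window md pI p0.
  by exists (f, g) => //; rewrite /D /= fd gd.
move=> [[f g] fgd <-] /eqP fg0; split; last exact/eqP.
have /andP[fd gd] : decr f && decr g := fgd.
have p0 : fcoef (term (gpar_of g, gpar_of f)) m != 0 := fg0.
have gf := is_gpar_of fd; have gg := is_gpar_of gd.
rewrite fcoef_term in p0.
split=> [//|i|i|i]; rewrite !ffunE /=.
- rewrite leNgt; apply/negP => h; move: p0.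
  by rewrite (coefC'_eq0 gg (i := i)) ?mulr0 ?eqxx // ffunE.
- by rewrite lez_nat.
- rewrite leNgt; apply/negP => h; move: p0.
  by rewrite (coefC_eq0 gf (i := i)) ?mul0r ?eqxx // ffunE.
Qed.

End Expansion.

(** * Fillings as tableaux of varying shape *)

Section Fillings.
Variables (n : nat) (lam mu : {ffun 'I_n -> nat}).

Definition ext0 (v : {ffun 'I_n -> nat}) (k : nat) : nat :=
  if insub k is Some i then v i else 0%N.

Lemma ext0E v (i : 'I_n) : ext0 v i = v i.
Proof. by rewrite /ext0 valK. Qed.

Lemma ext0_out v k : (n <= k)%N -> ext0 v k = 0%N.
Proof. by move=> nk; rewrite /ext0 insubF // ltnNge nk. Qed.

Lemma ext0_decr v : is_part v -> forall i j, (i <= j)%N -> (ext0 v j <= ext0 v i)%N.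
Proof.
move=> pv i j ij; have [nj|jn] := leqP n j; first by rewrite ext0_out.
have ilt := leq_ltn_trans ij jn.
by rewrite -[i]/(val (Ordinal ilt)) -[j]/(val (Ordinal jn)) !ext0E; exact: pv.
Qed.

Definition ext (T : filling lam mu) : tab := fun k j =>
  if [pick c : skew_cell lam mu | (cell_row c == k) && (cell_col c == j)] is Some c
  then T c else [::].

Lemma cell_inj (c d : skew_cell lam mu) :
  cell_row c = cell_row d -> cell_col c = cell_col d -> c = d.
Proof.
case: c d => [i t] [j u]; rewrite /cell_row /cell_col /= => /val_inj E; subst j.
by move=> /addnI/val_inj ->.
Qed.

Lemma ext_cell T c : ext T (cell_row c) (cell_col c) = T c.
Proof.
rewrite /ext; case: pickP => [d /andP[/eqP h1 /eqP h2]|/(_ c)]; last by rewrite !eqxx.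
by rewrite (cell_inj h1 h2).
Qed.

Lemma ext_neq0 T k j : ext T k j != [::] ->
  exists c, [/\ cell_row c = k, cell_col c = j & ext T k j = T c].
Proof.
rewrite /ext; case: pickP => // c /andP[/eqP h1 /eqP h2] _.
by exists c.
Qed.

Lemma cell_inshape (c : skew_cell lam mu) : inshape (ext0 mu) (ext0 lam) (cell_row c) (cell_col c).
Proof.
rewrite /inshape /cell_row !ext0E /cell_col leq_addr /=.
by case: c => i t /=; have := ltn_ord t; lia.
Qed.

Lemma inshape_cell k j : inshape (ext0 mu) (ext0 lam) k j ->
  exists c : skew_cell lam mu, cell_row c = k /\ cell_col c = j.
Proof.
have [nk|kn] := leqP n k; first by rewrite /inshape (ext0_out lam nk) ltn0 andbF.
rewrite -[k]/(val (Ordinal kn)); set i := Ordinal kn.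
rewrite /inshape !ext0E => /andP[h1 h2].
have t : (j - mu i < lam i - mu i)%N by lia.
exists (Tagged (fun i => 'I_(lam i - mu i)) (Ordinal t)).
by rewrite /cell_row /cell_col /=; split=> //; lia.
Qed.

Definition unext (T : tab) : filling lam mu := [ffun c => T (cell_row c) (cell_col c)].

Lemma extK : cancel ext unext.
Proof. by move=> T; apply/ffunP => c; rewrite ffunE ext_cell. Qed.

Lemma ext_out T M : (forall k, ext0 lam k <= M)%N ->
  forall k j, (n <= k)%N || (M <= j)%N -> ext T k j = [::].
Proof.
move=> lM k j H; apply/eqP/negPn/negP => /ext_neq0[c [ck cj _]].
have := cell_inshape c; rewrite ck cj /inshape; have := lM k.
by case/orP: H => [/(ext0_out lam) ->|]; lia.
Qed.

Lemma ext_tab (T : filling lam mu) L i : is_tableau T ->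
    (forall k j, ext T k j != [::] -> (mmax (ext T k j) < L + (i <= k))%N) ->
  is_tab (ext0 mu) (ext0 lam) L i (ext T).
Proof.
move=> [Tm Tr Tc] Tb; have T0 c : T c != [::] by case: (T c) (Tm c).
split=> //.
- move=> k j; apply/idP/idP => [/ext_neq0[c [<- <- _]]|/inshape_cell[c [<- <-]]].
    exact: cell_inshape.
  by rewrite ext_cell.
- by move=> k j /ext_neq0[c [_ _ ->]].
- move=> k j /ext_neq0[c [ck cj ->]] /ext_neq0[d [dk dj ->]].
  by apply: Tr; rewrite ?ck ?cj.
- move=> k j /ext_neq0[c [ck cj ->]] /ext_neq0[d [dk dj ->]].
  by apply: Tc; rewrite ?ck ?cj.
Qed.

Lemma tab_unext (T : tab) L i : is_tab (ext0 mu) (ext0 lam) L i T ->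
  is_tableau (unext T) /\ ext (unext T) = T.
Proof.
move=> tT; have T0 (c : skew_cell lam mu) : T (cell_row c) (cell_col c) != [::].
  by rewrite (tab_shape tT) cell_inshape.
split.
  split=> [c|c d dr dc|c d dr dc]; rewrite !ffunE.
  - exact: (tab_mmset tT).
  - by rewrite dr dc; apply: (tab_row tT) => //; rewrite -dr -?dc.
  - by rewrite dr dc; apply: (tab_col tT) => //; rewrite -?dr -dc.
apply/funext => k; apply/funext => j.
have [kj|kj] := boolP (inshape (ext0 mu) (ext0 lam) k j).
  by have [c [<- <-]] := inshape_cell kj; rewrite ext_cell ffunE.
have /eqP -> : T k j == [::] by rewrite -[_ == _]negbK (tab_shape tT).
by apply/eqP/negPn/negP => /ext_neq0[c [ck cj _]]; rewrite -ck -cj cell_inshape in kj.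
Qed.

Variables (R : comNzRingType) (alpha beta : nat -> R).

Lemma wt_ext M T : (forall k, ext0 lam k <= M)%N ->
  wt alpha beta T = twt alpha beta n M (ext T).
Proof.
move=> lM; have cM (c : skew_cell lam mu) : (cell_col c < M)%N.
  by have := cell_inshape c; rewrite /inshape; have := lM (cell_row c); lia.
pose h (c : skew_cell lam mu) : 'I_n * 'I_M := (tag c, Ordinal (cM c)).
have hi : injective h.
  by move=> c d [h1 h2]; apply: cell_inj; rewrite /cell_row ?h1.
rewrite /twt pair_big /= (bigID (fun p => p \in codom h)) /= [X in _ = _ * X]big1; last first.
  move=> [k j] /= kj.
  have -> : ext T k j = [::].
    apply/eqP/negPn/negP => /ext_neq0[c [ck cj _]]; case/negP: kj; apply/codomP.
    by exists c; congr (_, _); apply/val_inj.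
  by rewrite /wcell big_nil /= (mulr1 (1 : R)) fpsC1; ring.
rewrite mulr1.
transitivity (\prod_(p in [set h c | c in [set: skew_cell lam mu]%SET]%SET)
    wcell alpha beta p.1 p.2 (ext T p.1 p.2)).
  rewrite big_imset /=; last by move=> c d _ _; exact: hi.
  by apply: eq_big => [c|c _]; rewrite ?inE // -[T c]ext_cell.
apply: eq_bigl => p; apply/imsetP/codomP => [[c _ ->]|[c ->]]; first by exists c.
by exists c; rewrite ?inE.
Qed.

Lemma wt_summable : fps_summable [set T : filling lam mu | is_tableau T] (wt alpha beta).
Proof.
pose M := (\max_(i < n) lam i)%N.
have lM k : (ext0 lam k <= M)%N.
  rewrite /ext0; case: insubP => // i _ _; exact: (leq_bigmax i).
move=> m; apply: (@sub_finite_set _ _ (unext @` [set T' |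
    (ext @` [set T | is_tableau T]) T' /\ fcoef (twt alpha beta n M T') m != 0])).
  move=> T [/= tT Tm]; exists (ext T); last exact: extK.
  by split; [exists T|rewrite -wt_ext].
apply: finite_image; apply: twt_summable => _ [T _ <-]; exact: ext_out.
Qed.

(** A filling that contributes at [m] has its entries in the support of [m], hence below [L], and so
    meets the bound of stage ([L], 0). *)
Lemma fcoef_Gskew M L m : (forall k, ext0 lam k <= M)%N -> supp_lt L m ->
  fcoef (Gskew lam mu alpha beta) m =
  fcoef (fps_sum [set T | is_tab (ext0 mu) (ext0 lam) L 0 T] (twt alpha beta n M)) m.
Proof.
move=> lM /supp_ltP Lm.
transitivity (\sum_(T \in [set T : filling lam mu | is_tableau T]) fcoef (wt alpha beta T) m);
  first by [].
transitivity (\sum_(T \in ext @` [set T | is_tableau T]) fcoef (twt alpha beta n M T) m).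
  rewrite fsbig_image; last by move=> T T' _ _ /(can_inj extK).
  by apply: eq_fsbigr => T _; rewrite (wt_ext _ lM).
transitivity (\sum_(T \in [set T | is_tab (ext0 mu) (ext0 lam) L 0 T])
    fcoef (twt alpha beta n M T) m); last by [].
rewrite fsbig_supp [RHS]fsbig_supp; apply: eq_fsbigl; apply/seteqP; split=> T [].
  move=> [T' tT' <-] T'm; split=> //; apply: ext_tab => // k j T'kj.
  have T'kj' := T'kj; move/ext_neq0: T'kj' => [c [ck cj cE]].
  have sh := cell_inshape c; rewrite ck cj /inshape in sh.
  have kn : (k < n)%N by rewrite ltnNge; apply/negP => /(ext0_out lam); move: sh; lia.
  have jM : (j < M)%N by have := lM k; move: sh; lia.
  have lastin : last (0%N, false) (ext T' k j) \in ext T' k j.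
    by case: (ext T' k j) T'kj => [//|a s _]; exact: (mem_last a s).
  have /eqP nz := T'm; have := twt_bound nz kn jM lastin.
  rewrite -cmE_neq0 => h; rewrite addn1; apply: ltnW; rewrite ltnS ltnNge; apply/negP => /Lm.
  by move: h => /eqP.
move=> tT Tm; split=> //; have [tU UE] := tab_unext tT.
by exists (unext T).
Qed.

End Fillings.

(** * Comparison of coefficients *)

Lemma eqmod_Cfactor (R : comNzRingType) n (beta : nat -> R) L m : supp_lt L m ->
  eqmod m (Cfactor n beta) (gpref n beta L 0).
Proof.
move=> /supp_ltP Lm; apply: eqmod_prod => k a /in_mdivs am.
have aL j : (L <= j)%N -> a j = 0%N by move=> /Lm mj; have := am j; rewrite mj; lia.
(* A variable [x_l] with [l >= L] does not divide [a], so its factor leaves the coefficient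
   unchanged. *)
have E N : (L <= N)%N ->
    fcoef (\prod_(l < N) (1 - fpsC (beta k) * fpsX R l)) a =
    fcoef (\prod_(l < L) (1 - fpsC (beta k) * fpsX R l)) a.
  move=> /subnKC <-; elim: (N - L)%N => [|j IHj]; first by rewrite addn0.
  by rewrite addnS big_ord_recr fcoef_mulBX // aL // leq_addr.
by rewrite /fps_prod (fps_limP (N := L)) // E // leq_addr.
Qed.

Theorem theorem8p2 (R : comNzRingType) (n : nat) (alpha beta : nat -> R)
    (lam mu : {ffun 'I_n -> nat}) :
    is_part lam -> is_part mu -> (forall i, (mu i <= lam i)%N) ->
  [/\ fps_summable [set T : filling lam mu | is_tableau T] (wt alpha beta),
      fps_summable (expansion_index lam mu) (expansion_term alpha beta lam mu)
    & Gskew lam mu alpha beta =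
        Cfactor n beta *
        fps_sum (expansion_index lam mu) (expansion_term alpha beta lam mu)].
Proof.
move=> lamp mup mulam; pose mu0 := (\max_(i < n) mu i)%N.
have mu0P i : (mu i <= mu0)%N by exact: (leq_bigmax i).
split; first exact: wt_summable.
  by move=> m; apply: (term_finite _ _ mulam mu0P (leqnn (mdeg m))).
apply: fpsP => m.
have [L Lm] : exists L, supp_lt L m.
  exists (\max_(i <- finsupp m) i.+1)%N; apply/allP => i im.
  exact: (@leq_bigmax_seq _ _ xpredT (fun i => i.+1)).
have gl : admissible n (ext0 lam 0) (ext0 mu) (ext0 lam).
  split=> //; first exact: ext0_decr.
    move=> i; have [ni|ilt] := leqP n i; first by rewrite ext0_out.
    by rewrite -[i]/(val (Ordinal ilt)) !ext0E.
  by move=> i; exact: ext0_out.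
have lM k : (ext0 lam k <= ext0 lam 0)%N by exact: ext0_decr.
rewrite (fcoef_Gskew _ _ _ lM Lm) (tab_sum_gdet alpha beta (ext0_decr mup) L gl (leq0n n)).
have sL : forall a, a \in mdivs m -> supp_lt L a.
  move=> a /in_mdivs am; apply/supp_ltP => j Lj; move/supp_ltP/(_ j Lj): Lm => mj.
  by have := am j; rewrite mj; lia.
(* A coefficient of a product involves all divisors of [m], so both factors are compared at each of
   them. *)
apply: (eqmod_mul (m := m)); last exact: mdivs_id.
  by move=> a am; rewrite (eqmod_Cfactor n beta Lm).
move=> a am.
have ad : (mdeg a <= mdeg m)%N.
  have /eqP <- : mmul a (divcm m a) == m by rewrite divcmP am eqxx.
  by rewrite mdegM leq_addr.
rewrite (fcoef_expansion _ _ lamp mup mulam mu0P ad).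
(* The window is chosen for degree [mdeg m]; entrywise agreement with the Jacobi-Trudi matrix at the
   divisors of [m] suffices. *)
apply: (eqmod_det (m := m)) am => i j b bm.
rewrite (fcoef_window _ _ _ mu0P); last first.
  have /eqP <- : mmul b (divcm m b) == m by rewrite divcmP bm eqxx.
  by rewrite mdegM leq_addr.
rewrite mxE /=; have -> : supp_lt (L + 1) b.
  by apply/supp_ltP => k Lk; move/supp_ltP: (sL _ bm); apply; lia.
by rewrite /wco !ext0E.
Qed.
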